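(* Let $\varphi$ be a quasi-concave function for which there is a constant $C>0$ with $\varphi(t)\ge C\,t\log(1+1/t)$ for all $t>0$. If there exists an r.i. Banach space $X$ such that $R(X)=\Lambda_\varphi$, then $R(\mathfrak{R}[S,\Lambda_\varphi])=\Lambda_\varphi$.
   Context: All function spaces consist of measurable functions on $(0,\infty)$ with Lebesgue measure; ''r.i.'' means rearrangement invariant, and r.i. Banach spaces are rearrangement invariant Banach function spaces in the sense of Bennett–Sharpley. Equality of spaces means equality as sets with equivalent (quasi-)norms; inclusions are continuous. ''Increasing'' and ''decreasing'' are in the weak sense. $f^*$ is the decreasing rearrangement of $f$. A function $\varphi:(0,\infty)\to(0,\infty)$ is quasi-concave if it is increasing and $\varphi(t)/t$ is decreasing; we put $\varphi(0)=0$. The Lorentz space $\Lambda_\varphi$ consists of all $f$ with $\|f\|_{\Lambda_\varphi}=\int_0^\infty f^*(t)\,d\varphi(t)<\infty$, where the Stieltjes integral includes the mass $\varphi(0+)$ at the origin, i.e. $\|f\|_{\Lambda_\varphi}=\varphi(0+)\|f\|_\infty+\int_0^\infty f^*(t)\varphi'(t)\,dt$ (with $0\cdot\infty=0$). For an r.i. space $X$, $W_X(t)=\big\|\frac{1}{1+\cdot/t}\big\|_X$ and $R(X)=\Lambda_{W_X}$; if $1/(1+s)\notin X$ then $R(X)=\{0\}$. The Hardy operator is $Sf(t)=\frac1t\int_0^t f(r)\,dr$. $\mathfrak{R}[S,\Lambda_\varphi]$ denotes the minimal r.i. Banach function space $Y$ such that $S:\Lambda_\varphi\to Y$ is bounded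 (i.e. $S:\Lambda_\varphi\to Y$ is bounded and $Y\subset Z$ for every r.i. Banach space $Z$ such that $S:\Lambda_\varphi\to Z$ is bounded). Under the hypothesis $\varphi(t)\ge C\,t\log(1+1/t)$ this space exists. *)

(* Defs.v *)
From HB Require Import structures.
From mathcomp Require Import all_boot all_order all_algebra.
From mathcomp Require Import all_classical all_reals all_analysis.
From mathcomp Require Import measurable_realfun.
Import Order.TTheory GRing.Theory Num.Theory.
Import numFieldNormedType.Exports.

Set Implicit Arguments.
Unset Strict Implicit.
Unset Printing Implicit Defensive.

Local Open Scope classical_set_scope.
Local Open Scope ring_scope.
Local Open Scope ereal_scope.

(* A function on (0,oo) is represented by a map f : R -> \bar R of which only
   the values on halfline are ever used. *)
Definition halfline {R : realType} : set R := `]0%R, +oo[.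

Definition ae_halfline {R : realType} (P : R -> Prop) : Prop :=
  {ae @lebesgue_measure R, forall x, halfline x -> P x}.

(* The cone M^+ of Bennett-Sharpley: the value +oo is allowed. *)
Definition Mplus {R : realType} : set (R -> \bar R) :=
  [set f | measurable_fun halfline f /\ forall x, halfline x -> 0 <= f x].

Definition distr {R : realType} (f : R -> \bar R) (s : R) : \bar R :=
  lebesgue_measure [set x | halfline x /\ s%:E < `|f x|].

Definition rearr {R : realType} (f : R -> \bar R) (t : R) : \bar R :=
  ereal_inf [set s%:E | s in [set s : R | (0 <= s)%R /\ distr f s <= t%:E]].

Definition equimeasurable {R : realType} (f g : R -> \bar R) : Prop :=
  forall s : R, (0 <= s)%R -> distr f s = distr g s.

(* Rearrangement invariant Banach function norms: Bennett-Sharpley's axioms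
   (P1)-(P5), followed by rearrangement invariance. *)
Record is_ri_norm {R : realType} (rho : (R -> \bar R) -> \bar R) : Prop := {
  rho_ge0 : forall f, Mplus f -> 0 <= rho f ;
  rho_eq0 : forall f, Mplus f ->
    (rho f = 0 <-> ae_halfline (fun x => f x = 0)) ;
  rhoZ : forall (a : R) f, (0 <= a)%R -> Mplus f ->
    rho (fun x => a%:E * f x) = a%:E * rho f ;
  rhoD : forall f g, Mplus f -> Mplus g ->
    rho (fun x => f x + g x) <= rho f + rho g ;
  rho_le : forall f g, Mplus f -> Mplus g ->
    ae_halfline (fun x => g x <= f x) -> rho g <= rho f ;
  rho_fatou : forall (u : nat -> R -> \bar R) f,
    (forall n, Mplus (u n)) -> Mplus f ->
    ae_halfline (fun x =>
      (forall n, u n x <= u n.+1 x) /\ u n x @[n --> \oo] --> f x) ->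
    (forall n, rho (u n) <= rho (u n.+1)) /\ rho (u n) @[n --> \oo] --> rho f ;
  rho_indic : forall E : set R, measurable E -> E `<=` halfline ->
    lebesgue_measure E < +oo -> rho (fun x => (\1_E x)%:E) < +oo ;
  rho_int : forall E : set R, measurable E -> E `<=` halfline ->
    lebesgue_measure E < +oo ->
    exists2 C : R, (0 < C)%R &
      forall f, Mplus f -> \int[lebesgue_measure]_(x in E) f x <= C%:E * rho f ;
  rho_ri : forall f g, Mplus f -> Mplus g ->
    ae_halfline (fun x => f x \is a fin_num) ->
    ae_halfline (fun x => g x \is a fin_num) ->
    equimeasurable f g -> rho f = rho g
}.

Record riSpace (R : realType) := RiSpace {
  ri_rho : (R -> \bar R) -> \bar R ;
  ri_rhoP : is_ri_norm ri_rho
}.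

(* A set of functions with a (quasi-)norm, which matters only on that set. *)
Record funSpace (R : realType) := FunSpace {
  carrier : set (R -> \bar R) ;
  fnorm : (R -> \bar R) -> \bar R
}.

Definition space_eq {R : realType} (X Y : funSpace R) : Prop :=
  (forall f, carrier X f <-> carrier Y f) /\
  exists c C : R, [/\ (0 < c)%R, (0 < C)%R &
    forall f, carrier X f -> c%:E * fnorm X f <= fnorm Y f <= C%:E * fnorm X f].

Definition bounded_operator {R : realType}
    (T : (R -> \bar R) -> (R -> \bar R)) (X Y : funSpace R) : Prop :=
  exists2 C : R, (0 < C)%R &
    forall f, carrier X f ->
      carrier Y (T f) /\ fnorm Y (T f) <= C%:E * fnorm X f.

Definition space_incl {R : realType} (X Y : funSpace R) : Prop :=
  bounded_operator idfun X Y.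

Definition space_of {R : realType} (X : riSpace R) : funSpace R :=
  let nrm f := ri_rho X (fun x => `|f x|) in
  FunSpace [set f | measurable_fun halfline f /\ nrm f < +oo] nrm.

Coercion space_of : riSpace >-> funSpace.

Definition zero_space {R : realType} : funSpace R :=
  FunSpace [set f | measurable_fun halfline f /\ ae_halfline (fun x => f x = 0)]
           (fun _ => 0).

Definition quasi_concave {R : realType} (phi : R -> R) : Prop :=
  [/\ forall t : R, (0 < t)%R -> (0 < phi t)%R,
      forall s t : R, (0 < s)%R -> (s <= t)%R -> (phi s <= phi t)%R &
      forall s t : R, (0 < s)%R -> (s <= t)%R -> (phi t / t <= phi s / s)%R].

(* Quasi-concave functions are locally Lipschitz on (0,oo), so the derivative
   exists almost everywhere there; 'N[_]_+oo is the essential supremum. *)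
Definition Lorentz_norm {R : realType} (phi : R -> R) (f : R -> \bar R)
    : \bar R :=
  (lim (phi t @[t --> 0%R^'+]))%:E * 'N[@lebesgue_measure R]_+oo [f \_ halfline]
  + \int[lebesgue_measure]_(t in halfline) (rearr f t * (derive1 phi t)%:E).

Definition Lorentz {R : realType} (phi : R -> R) : funSpace R :=
  FunSpace [set f | measurable_fun halfline f /\ Lorentz_norm phi f < +oo]
           (Lorentz_norm phi).

Definition W {R : realType} (X : riSpace R) (t : R) : \bar R :=
  fnorm X (fun s => ((1 + s / t)^-1)%:E).

Definition RX {R : realType} (X : riSpace R) : funSpace R :=
  if `[< carrier X (fun s => ((1 + s)^-1)%:E) >]
  then Lorentz (fun t => fine (W X t))
  else zero_space.

Definition Hardy {R : realType} (f : R -> \bar R) (t : R) : \bar R :=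
  (t^-1)%:E * \int[lebesgue_measure]_(r in `]0%R, t[) f r.

(* Y is (a representative, up to space_eq, of) the minimal r.i. range space
   of the Hardy operator on the Lorentz space of phi. *)
Definition is_minimal_range {R : realType} (phi : R -> R) (Y : riSpace R)
    : Prop :=
  bounded_operator Hardy (Lorentz phi) Y /\
  forall Z : riSpace R,
    bounded_operator Hardy (Lorentz phi) Z -> space_incl Y Z.

(* Main.v *)
Require Import Defs.
From HB Require Import structures.
From mathcomp Require Import all_boot all_order all_algebra.
From mathcomp Require Import all_classical all_reals all_analysis.
From mathcomp Require Import measurable_realfun ess_sup_inf ring lra.
Import Order.TTheory GRing.Theory Num.Theory.
Import numFieldNormedType.Exports HBSimple HBNNSimple.

Set Implicit Arguments.
Unset Strict Implicit.
Unset Printing Implicit Defensive.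

(** Cutting [|f|] at the heights [2 ^ k] shows that, for quasi-concave [phi],
    the Lorentz norm of [f] is equivalent to the sum over the integers [k] of
    [2 ^ k * phi (|{ |f| > 2 ^ k }|)].  So equivalent functions [phi] give the
    same Lorentz space, and the Hardy operator [S] is bounded from [Lambda_phi]
    to [X] as soon as it is so on indicator functions.  As [S 1_(0,t)] is
    comparable to [1 / (1 + . / t)], this means [W_X <= C phi].  If
    [R(X) = Lambda_phi], then [W_X] and [phi] are equivalent, so [S] maps
    [Lambda_phi] to [X]; the minimal range [Y] then exists (the supremum of all
    r.i. norms for which [S] is a contraction), and [S : Lambda_phi -> Y] gives
    [W_Y <= C phi] while [Y] being included in [X] gives
    [phi <= C W_X <= C' W_Y]. *)

Local Open Scope classical_set_scope.
Local Open Scope ring_scope.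
Local Open Scope ereal_scope.

(** * Lipschitz and quasi-concave functions *)

(** Two obstacles shape the argument. [Lorentz_norm] is written with [derive1 phi], and an
    inequality [phi <= C psi] says nothing about derivatives; and for a merely quasi-concave [phi]
    it need not satisfy the triangle inequality, so sums are estimated only in the range space,
    whose norm is countably subadditive by the Fatou property. Cutting into levels removes both: it
    leaves values of [phi] only, and indicators to test on. The bridge is the formula
    [phi d = phi(0+) + \int_0^d phi'], which turns [phi] of a distribution function into an integral
    over the [t] below it; for fixed [t] the levels that contribute are those under the
    rearrangement at [t], a geometric series of that size. On the operator side the estimates rest
    on [t / (t + s) <= min(1, t / s) <= 2 t / (t + s)], the middle term being the Hardy average of
    the indicator of [(0, t)] at [s]. The supremum of norms is finite on indicators because all
    competitors share the constant 1, and each bounded range enters the family after rescaling. *)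

Lemma lipschitz_rcts {R : realType} (F : R -> R) (K : R) :
  {homo F : x y / (x <= y)%R} ->
  (forall x y : R, (x <= y)%R -> (F y - F x <= K * (y - x))%R) ->
  right_continuous F.
Proof.
move=> ndF FK x; apply/cvgrPdist_lt => /= e e0.
have K1 : (0 < `|K| + 1)%R by rewrite ltr_wpDl.
have dpos : (0 < e / (`|K| + 1))%R by rewrite divr_gt0.
near=> y.
have xy : (x < y)%R by near: y; exact: nbhs_right_gt.
have yx : (y - x < e / (`|K| + 1))%R.
  by rewrite ltrBlDl; near: y; apply: nbhs_right_lt; rewrite ltrDl.
rewrite distrC ger0_norm ?subr_ge0 ?ndF ?ltW//.
apply: (le_lt_trans (FK _ _ (ltW xy))).
rewrite (@le_lt_trans _ _ ((`|K| + 1) * (y - x)))%R//.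
  rewrite ler_wpM2r ?subr_ge0 ?(ltW xy)//.
  by rewrite (le_trans (ler_norm _))// lerDl.
by rewrite mulrC -ltr_pdivlMr.
Unshelve. all: by end_near. Qed.

Lemma lebesgue_stieltjes_ocitv {R : realType} (F : cumulative R R) (x y : R) :
  (x <= y)%R -> lebesgue_stieltjes_measure F `]x, y] = (F y - F x)%:E.
Proof.
move=> xy; rewrite /lebesgue_stieltjes_measure /measure_extension.
rewrite measurable_mu_extE/=; last exact: is_ocitv.
by rewrite wlength_itv_bnd.
Qed.

(* [K x - F x] is nondecreasing too, so the Stieltjes measure of [F] is
   dominated by [K] times Lebesgue measure. *)
Lemma lipschitz_stieltjes_dominates {R : realType} (F : cumulative R R) (K : R) :
  (0 <= K)%R ->
  (forall x y : R, (x <= y)%R -> (F y - F x <= K * (y - x))%R) ->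
  lebesgue_stieltjes_measure F `<< @lebesgue_measure R.
Proof.
move=> K0 FK.
have ndF : {homo F : x y / (x <= y)%R}.
  by move=> x y; exact: cumulative_is_nondecreasing.
pose H : R -> R := fun x => (K * x)%R.
have ndH : {homo H : x y / (x <= y)%R} by move=> x y; exact: ler_wpM2l.
have HK x y : (x <= y)%R -> (H y - H x <= K * (y - x))%R.
  by rewrite /H mulrBr.
pose G : R -> R := fun x => (K * x - F x)%R.
have ndG : {homo G : x y / (x <= y)%R}.
  by move=> x y xy; have := FK _ _ xy; rewrite /G mulrBr; lra.
have GK x y : (x <= y)%R -> (G y - G x <= K * (y - x))%R.
  by move=> xy; have := ndF _ _ xy; rewrite /G mulrBr; lra.
pose cH : cumulative R R :=
  HB.pack H (isCumulative.Build R _ R H ndH (lipschitz_rcts ndH HK)).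
pose cG : cumulative R R :=
  HB.pack G (isCumulative.Build R _ R G ndG (lipschitz_rcts ndG GK)).
pose mu : {measure set (measurableTypeR R) -> \bar R} :=
  mscale (NngNum K0) (@lebesgue_measure R).
pose nu : {measure set (measurableTypeR R) -> \bar R} :=
  measure_add (lebesgue_stieltjes_measure F) (lebesgue_stieltjes_measure cG).
have Hmu A : measurable A -> lebesgue_stieltjes_measure cH A = mu A.
  apply: lebesgue_stieltjes_measure_unique => _ /ocitvP[->|[[x y] /= xy ->]].
    by rewrite !measure0.
  rewrite lebesgue_stieltjes_ocitv ?ltW//.
  rewrite /mu/= /mscale/= lebesgue_measure_itv/= lte_fin xy.
  by rewrite -EFinD -EFinM mulrBr.
have Hnu A : measurable A -> lebesgue_stieltjes_measure cH A = nu A.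
  apply: lebesgue_stieltjes_measure_unique => _ /ocitvP[->|[[x y] /= xy ->]].
    by rewrite !measure0.
  rewrite /nu/= /measure_add/= /msum !big_ord_recr/= big_ord0 add0e.
  by rewrite !lebesgue_stieltjes_ocitv ?ltW// -EFinD /= /H /G; congr _%:E; ring.
apply/null_content_dominatesP => A mA A0.
have muA : mu A = 0 by rewrite /mu/= /mscale/= A0 mule0.
have : nu A = 0 by rewrite -Hnu// Hmu.
rewrite /nu/= /measure_add/= /msum !big_ord_recr/= big_ord0 add0e => nuA.
by apply/eqP; rewrite eq_le measure_ge0 andbT -nuA leeDl.
Qed.

Lemma near_addc_derive1 {R : realType} (F G : R -> R) (c x : R) :
  {near x, (fun y => c + G y)%R =1 F} -> derivable G x 1 ->
  derivable F x 1 /\ derive1 F x = derive1 G x.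
Proof.
move=> FG dG.
have dc : derivable (cst c : R -> R) x 1 by exact: derivable_cst.
have dFG : derivable (cst c + G : R -> R)%R x 1 by exact: derivableD.
have FG' : {near x, (cst c + G : R -> R)%R =1 F} by [].
split; first exact: near_eq_derivable FG' dFG.
rewrite !derive1E -(near_eq_derive _ FG') ?oner_neq0//.
by rewrite deriveD// derive_cst add0r.
Qed.

(** Radon-Nikodym supplies the density and Lebesgue differentiation identifies it with the
    derivative. The Stieltjes measure is cut down to []a, b]] to make it finite, which is why the
    integral formula stays between [a] and [b]. *)
Lemma lipschitz_density {R : realType} (F : R -> R) (K a b : R) :
  (a < b)%R -> (0 <= K)%R -> {homo F : x y / (x <= y)%R} ->
  (forall x y : R, (x <= y)%R -> (F y - F x <= K * (y - x))%R) ->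
  exists g : R -> R, [/\ measurable_fun setT g, forall x, (0 <= g x)%R,
    forall x y, (a <= x)%R -> (x <= y)%R -> (y <= b)%R ->
      \int[lebesgue_measure]_(t in `]x, y]) (g t)%:E = (F y - F x)%:E &
    {ae @lebesgue_measure R, forall x, (a < x < b)%R ->
      derivable F x 1 /\ derive1 F x = g x}].
Proof.
move=> ab K0 ndF FK.
pose cF : cumulative R R :=
  HB.pack F (isCumulative.Build R _ R F ndF (lipschitz_rcts ndF FK)).
have mab : measurable (`]a, b]%classic : set (measurableTypeR R)) by [].
have finab : lebesgue_stieltjes_measure cF `]a, b]%classic < +oo.
  by rewrite lebesgue_stieltjes_ocitv ?ltW// ltry.
pose nu : {finite_measure set (measurableTypeR R) -> \bar R} :=
  mfrestr mab finab.
pose leb : {sigma_finite_measure set (measurableTypeR R) -> \bar R} :=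
  @lebesgue_measure R.
have nuleb : nu `<< leb.
  apply/null_content_dominatesP => A mA A0.
  have /null_content_dominatesP dom := @lipschitz_stieltjes_dominates R cF K K0 FK.
  rewrite /nu/= /mfrestr/= /mrestr; apply: dom; first exact: measurableI.
  by apply: (subset_measure0 _ _ _ A0) => //; exact: measurableI.
have [f [f0 ffin intf fE]] := radon_nikodym_sigma_finite nuleb.
pose g : R -> R := fine \o f.
have gE x : (g x)%:E = f x by rewrite /g/= fineK.
have ig : lebesgue_measure.-integrable [set: R] (EFin \o g).
  by rewrite (_ : EFin \o g = f)//; apply/funext => x /=.
have intgE x y : (a <= x)%R -> (x <= y)%R -> (y <= b)%R ->
    \int[lebesgue_measure]_(t in `]x, y]) (g t)%:E = (F y - F x)%:E.
  move=> ax xy yb; under eq_integral do rewrite gE.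
  have <- : nu `]x, y]%classic = (F y - F x)%:E.
    rewrite /nu/= /mfrestr/= /mrestr setIidl ?lebesgue_stieltjes_ocitv//.
    move=> t /=; rewrite !in_itv/= => /andP[xt ty].
    by rewrite (le_lt_trans ax xt) (le_trans ty yb).
  by rewrite fE.
exists g; split => //.
- by apply/measurable_EFinP; exact: measurable_int ig.
- by move=> x; rewrite /g/= fine_ge0.
have lg : locally_integrable [set: R] g.
  by apply: open_integrable_locally => //; exact: openT.
have := @FTC1 R g (BRight a) _ lg.
move=> /(_ (fun y => integrableS measurableT _ (@subsetT _ _) ig)).
move=> /(_ (fun y => measurable_itv _)).
apply: filterS; first exact: (ae_filter_ringOfSetsType lebesgue_measure).
move=> x /= dx /andP[ax xb].
have [d1 d2] := dx ax.
set G := fun x => _ in d1 d2.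
have FG : {near x, (fun y => F a + G y)%R =1 F}.
  near=> y.
  have ay : (a < y)%R by near: y; exact: lt_nbhsr.
  have yb : (y < b)%R by near: y; exact: lt_nbhsl.
  by rewrite /G /Rintegral intgE ?lexx ?(ltW ay) ?(ltW yb)//= addrC subrK.
by rewrite -d2; exact: near_addc_derive1 FG d1.
Unshelve. all: by end_near. Qed.

(* The integral of a function which need not be measurable is a supremum over
   simple functions, so null sets still do not matter. *)
Lemma ge0_le_integral_ae d (T : measurableType d) (R : realType)
    (mu : {measure set T -> \bar R}) (f h : T -> \bar R) :
  (forall x, 0 <= f x) -> (forall x, 0 <= h x) ->
  {ae mu, forall x, f x <= h x} -> \int[mu]_x f x <= \int[mu]_x h x.
Proof.
move=> f0 h0 [N [mN N0 fhN]].
rewrite (ge0_integralTE mu f0) (ge0_integralTE mu h0).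
apply: ge_ereal_sup => _ [s /= sf <-].
(* Killing [s] on the null set [N] keeps its integral and puts it below [h] everywhere. *)
pose s' := mul_nnsfun s (indic_nnsfun R (measurableC mN)).
have -> : sintegral mu s = sintegral mu s'.
  rewrite -!integralT_nnsfun; apply: ge0_ae_eq_integral => //.
  - exact/measurable_EFinP.
  - exact/measurable_EFinP.
  - by move=> x _; rewrite lee_fin.
  - by move=> x _; rewrite lee_fin.
  exists N; split => // x /=; apply: contra_notP => Nx _.
  by rewrite /s' /= mindicE mem_set//= mulr1.
apply: ereal_sup_ubound; exists s' => // x.
rewrite /s' /= mindicE; have [Nx|Nx] := pselect (N x).
  by rewrite memNset/= ?mulr0//; apply.
rewrite mem_set//= mulr1 (le_trans (sf x))//.
by apply: contrapT => ?; apply: Nx; exact: fhN.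
Qed.

(** Meant for integrands containing [derive1 phi], about whose measurability nothing is known. Signs
    are arbitrary, so positive and negative parts are compared separately, in both directions. *)
Lemma ae_eq_integralW d (T : measurableType d) (R : realType)
    (mu : {measure set T -> \bar R}) (D : set T) (f h : T -> \bar R) :
  {ae mu, forall x, D x -> f x = h x} ->
  \int[mu]_(x in D) f x = \int[mu]_(x in D) h x.
Proof.
move=> fh; rewrite integral_mkcond [RHS]integral_mkcond.
have fhD : {ae mu, forall x, (f \_ D) x = (h \_ D) x}.
  apply: filterS fh => x fh; rewrite !patchE.
  by case: ifPn => // /set_mem; exact: fh.
have aux (u v : T -> \bar R) :
    {ae mu, forall x, u x = v x} -> (forall x, 0 <= u x) ->
    (forall x, 0 <= v x) -> \int[mu]_x u x = \int[mu]_x v x.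
  move=> uv u0 v0; apply/eqP; rewrite eq_le; apply/andP; split;
    apply: ge0_le_integral_ae => //; by apply: filterS uv => x ->.
rewrite integralE [RHS]integralE; congr (_ - _); apply: aux => //;
  by apply: filterS fhD => x fhx; rewrite ?funeposE ?funenegE fhx.
Qed.

Lemma ae_lebesgueS {R : realType} (P Q : R -> Prop) :
  (forall x, P x -> Q x) -> {ae @lebesgue_measure R, forall x, P x} ->
  {ae @lebesgue_measure R, forall x, Q x}.
Proof.
move=> PQ; apply: filterS => //.
exact: (ae_filter_ringOfSetsType lebesgue_measure).
Qed.

Lemma halflineE {R : realType} (x : R) : halfline x <-> (0 < x)%R.
Proof. by rewrite /halfline/= in_itv/= andbT. Qed.

Lemma measurable_halfline {R : realType} : measurable (@halfline R).
Proof. exact: measurable_itv. Qed.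

Lemma ndecr_halfline_measurable {R : realType} (f : R -> R) :
  (forall s t : R, (0 < s)%R -> (s <= t)%R -> (f s <= f t)%R) ->
  measurable_fun halfline f.
Proof.
(* Exponentiating makes the values positive, so that the extension by 0 to the left is monotone on
   the whole line; [ln] undoes it. *)
move=> fnd; pose h (t : R) := (if 0 < t then expR (f t) else 0)%R.
have hnd : nondecreasing_fun h.
  move=> s t st; rewrite /h; case: ifPn => [s0|_]; last first.
    by case: ifPn => // _; exact: expR_ge0.
  by rewrite (lt_le_trans s0 st) ler_expR; exact: fnd.
have mh : measurable_fun halfline h.
  by apply: nondecreasing_measurable => //; exact: measurable_halfline.
apply: (@eq_measurable_fun _ _ _ _ _ (@ln R \o h)).
  move=> t; rewrite inE => /halflineE t0.
  by rewrite /= /h t0 expRK.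
by apply: measurableT_comp mh; exact: measurable_ln.
Qed.

Lemma nincr_halfline_measurable {R : realType} (f : R -> R) :
  (forall s t : R, (0 < s)%R -> (s <= t)%R -> (f t <= f s)%R) ->
  measurable_fun halfline f.
Proof.
move=> fni; rewrite (_ : f = (-%R \o (fun t => - f t))%R).
  apply: measurableT_comp => //; apply: ndecr_halfline_measurable => s t s0 st.
  by rewrite lerN2 fni.
by apply/funext => t /=; rewrite opprK.
Qed.

(** * The derivative of a quasi-concave function *)

(** In the decomposition of [phi y - phi x] below, the first term is nonpositive and the slope
    [phi x / x] of the second is at most [phi a / a]. This constant may blow up at 0, whence the
    restriction to [a <= x]. *)
Lemma quasi_concave_lipschitz {R : realType} (phi : R -> R) (a x y : R) :
  quasi_concave phi -> (0 < a)%R -> (a <= x)%R -> (x <= y)%R ->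
  (phi y - phi x <= phi a / a * (y - x))%R.
Proof.
move=> [phi0 phind phini] a0 ax xy.
have x0 : (0 < x)%R by exact: lt_le_trans ax.
have y0 : (0 < y)%R by exact: lt_le_trans xy.
have h1 := phini _ _ x0 xy; have h2 := phini _ _ a0 ax.
have -> : (phi y - phi x = (phi y / y - phi x / x) * y + phi x / x * (y - x))%R.
  by field; rewrite !gt_eqF.
have yx : (0 <= y - x)%R by rewrite subr_ge0.
rewrite -[leRHS]add0r lerD//; last exact: ler_wpM2r.
by rewrite mulr_le0_ge0 ?subr_le0// ltW.
Qed.

Lemma quasi_concave_density_itv {R : realType} (phi : R -> R) (a b : R) :
  quasi_concave phi -> (0 < a)%R -> (a < b)%R ->
  exists g : R -> R, [/\ measurable_fun setT g, forall x, (0 <= g x)%R,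
    \int[lebesgue_measure]_(t in `]a, b]) (g t)%:E = (phi b - phi a)%:E &
    {ae @lebesgue_measure R, forall x, (a < x < b)%R ->
      derivable phi x 1 /\ derive1 phi x = g x}].
Proof.
move=> qc a0 ab; have [phi0 phind _] := qc.
(* Freezing [phi] to the left of [a] gives a monotone function that is Lipschitz on the whole
   line. *)
pose F t := phi (Num.max t a).
have Ma t : (a <= Num.max t a)%R by rewrite le_max lexx orbT.
have K0 : (0 <= phi a / a)%R by rewrite divr_ge0 ?ltW ?phi0.
have MM (x y : R) : (x <= y)%R -> (Num.max x a <= Num.max y a)%R.
  by move=> xy; rewrite ge_max !le_max xy lexx orbT.
have ndF : {homo F : x y / (x <= y)%R}.
  by move=> x y xy; rewrite /F phind ?MM ?(lt_le_trans a0).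
have FK (x y : R) : (x <= y)%R -> (F y - F x <= phi a / a * (y - x))%R.
  move=> xy; rewrite /F.
  rewrite (le_trans (quasi_concave_lipschitz qc a0 (Ma x) (MM _ _ xy)))//.
  rewrite ler_wpM2l//.
  have [xa|xa] := leP x a; have [ya|ya] := leP y a; lra.
have FE t : (a <= t)%R -> F t = phi t.
  by move=> a_t; rewrite /F; congr phi; apply/max_idPl.
have [g [mg g0 intg dg]] := lipschitz_density ab K0 ndF FK.
exists g; split => //.
  by rewrite intg ?lexx ?(ltW ab)// !FE// ltW.
apply: ae_lebesgueS dg => x dx /andP[ax xb].
have [|d1 d2] := dx; first by rewrite ax.
rewrite -d2; apply: (@near_addc_derive1 _ phi F 0%R x) => //.
near=> y; rewrite add0r FE// ltW//; near: y; exact: lt_nbhsr.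
Unshelve. all: by end_near. Qed.

Lemma derivable_quotient_cvg {R : realType} (f : R -> R) (x : R) :
  derivable f x 1 ->
  (n.+1%:R * (f (n.+1%:R^-1 + x) - f x))%R @[n --> \oo] --> derive1 f x.
Proof.
move=> df.
have cf : cvg ((fun h => h^-1 *: (f (h + x) - f x)) @ 0^')%R.
  move: df; rewrite /derivable; set d := (fun _ : R => _).
  by set d' := (fun _ : R => _); suff -> : d = d' by [];
     rewrite funeqE=> h; rewrite /d /d' /= [h%:A](mulr1).
have u0 n : ((n.+1%:R : R)^-1 != 0)%R by rewrite invr_neq0.
have /cvgr_dnbhsP := cf.
move=> /(_ (fun n => n.+1%:R^-1)%R) h.
have := h (conj u0 (@cvg_harmonic R)).
by under eq_fun do rewrite invrK.
Qed.

Lemma quasi_concave_cvg0 {R : realType} (phi : R -> R) :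
  quasi_concave phi ->
  phi t @[t --> 0%R^'+] --> lim (phi t @[t --> 0%R^'+]).
Proof.
move=> [phi0 phind _].
suff : cvg (phi t @[t --> 0%R^'+]) by [].
apply: nondecreasing_at_right_is_cvgr.
  apply: nearW => x; move=> s t; rewrite !in_itv/= => /andP[s0 _] _ st; exact: phind.
apply: nearW => x; exists 0%R => r [t /=]; rewrite in_itv/= => /andP[t0 _] <-.
exact/ltW/phi0.
Qed.

Lemma quasi_concave_lim0_ge0 {R : realType} (phi : R -> R) :
  quasi_concave phi -> (0 <= lim (phi t @[t --> 0%R^'+]))%R.
Proof.
move=> qc; have [phi0 _ _] := qc.
apply: limr_ge; first exact: quasi_concave_cvg0.
near=> t.
apply/ltW/phi0; near: t; exact: nbhs_right_gt.
Unshelve. all: by end_near. Qed.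

(** The density found on []a, b]] depends on the interval; a single measurable [g] is obtained from
    the upper limit of difference quotients, and equals the derivative wherever that exists and is
    nonnegative. The mass at the origin appears when the left end of the interval tends to 0. *)
Lemma quasi_concave_derivative {R : realType} (phi : R -> R) :
  quasi_concave phi ->
  exists g : R -> R, [/\ measurable_fun halfline g, forall x, (0 <= g x)%R,
    ae_halfline (fun t => derive1 phi t = g t) &
    forall d, (0 < d)%R ->
      (lim (phi t @[t --> 0%R^'+]))%:E +
        \int[lebesgue_measure]_(t in `]0%R, d[) (g t)%:E = (phi d)%:E].
Proof.
move=> qc; have [phi0 phind phini] := qc.
pose q (n : nat) (t : R) := (n.+1%:R * (phi (n.+1%:R^-1 + t) - phi t))%R.
pose g (t : R) : R := fine `|limn_esup (fun n => (q n t)%:E)|.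
have qcv t : derivable phi t 1 -> (0 <= derive1 phi t)%R ->
    derive1 phi t = g t.
  move=> dt d0; have cq : (q n t)%:E @[n --> \oo] --> (derive1 phi t)%:E.
    by apply: cvg_EFin; [exact: nearW|exact: derivable_quotient_cvg].
  by rewrite /g (cvg_limn_einf_sup cq).2 gee0_abs.
have ds a b : (0 < a)%R -> (a < b)%R -> exists h : R -> R,
   [/\ measurable_fun setT h, forall x, (0 <= h x)%R,
    \int[lebesgue_measure]_(t in `]a, b]) (h t)%:E = (phi b - phi a)%:E &
    {ae @lebesgue_measure R, forall x, (a < x < b)%R ->
      derive1 phi x = g x /\ derive1 phi x = h x}].
  move=> a0 ab; have [h [mh h0 ih dh]] := quasi_concave_density_itv qc a0 ab.
  exists h; split => //; apply: ae_lebesgueS dh => x dh /dh[d1 d2]; split => //.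
  by apply: qcv => //; rewrite d2.
have mq n : measurable_fun halfline (q n).
  apply: measurable_funM => //; apply: measurable_funB.
    apply: ndecr_halfline_measurable => s t s0 st.
    by apply: phind; rewrite ?lerD2l// ltr_wpDl.
  exact: ndecr_halfline_measurable.
have mg : measurable_fun halfline g.
  apply: measurableT_comp => //; apply: measurableT_comp => //.
  apply: measurable_fun_limn_esup => n.
  exact/measurable_EFinP.
exists g; split => //.
- by move=> x; rewrite fine_ge0.
- have ai (n : nat) : {ae @lebesgue_measure R, forall x,
      ((n.+2%:R^-1 : R) < x < n.+2%:R)%R -> derive1 phi x = g x}.
    have [||h [_ _ _ dh]] := ds (n.+2%:R^-1)%R n.+2%:R.
    + by rewrite invr_gt0.
    + by rewrite (@lt_trans _ _ 1%R) ?invf_lt1 ?ltr1n.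
    by apply: ae_lebesgueS dh => x /[swap] xn /(_ xn)[].
  have := ae_foralln ai; apply: ae_lebesgueS => x ax /halflineE x0.
  pose n := Num.bound (x + x^-1).
  have xb : (x + x^-1 < n.+2%:R)%R.
    have : (x + x^-1 < n%:R)%R.
      by apply: archi_boundP; apply: addr_ge0; rewrite ?invr_ge0 ltW.
    by move=> /lt_trans; apply; rewrite ltr_nat.
  apply: (ax n); apply/andP; split.
    rewrite invf_plt ?posrE//; apply: le_lt_trans xb.
    by rewrite lerDr ltW.
  by apply: le_lt_trans xb; rewrite lerDl invr_ge0 ltW.
move=> d d0.
(* The shift to [n.+2] keeps [a n] strictly below [d], already for [n = 0]. *)
pose a (n : nat) : R := (d / n.+2%:R)%R.
have a0 n : (0 < a n)%R by rewrite divr_gt0.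
have ad n : (a n < d)%R.
  by rewrite ltr_pdivrMr// ltr_pMr// ltr1n.
have acv : a n @[n --> \oo] --> 0%R.
  rewrite -[X in _ --> X](mulr0 d); apply: cvgMl_tmp.
  by have := @cvg_harmonic R; rewrite -(cvg_shiftS (@harmonic R)).
have subh n : `]a n, d[ `<=` @halfline R.
  move=> t /=; rewrite in_itv/= => /andP[ht _].
  by apply/halflineE; exact: lt_trans ht.
have iE n :
    \int[lebesgue_measure]_(t in `]a n, d[) (g t)%:E = (phi d - phi (a n))%:E.
  have [h [mh h0 ih dh]] := ds _ _ (a0 n) (ad n).
  rewrite -ih [RHS]integral_itv_bndoo.
    apply: ae_eq_integralW; apply: ae_lebesgueS dh => x dh /=.
    by rewrite in_itv/= => /dh[<- <-].
  by apply/measurable_EFinP; exact: measurable_funTS.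
have bE : \bigcup_n `]a n, d[%classic = `]0%R, d[%classic.
  apply/seteqP; split=> t /=; rewrite in_itv/=.
    by move=> [n _]/=; rewrite in_itv/= => /andP[ht ->]; rewrite (lt_trans _ ht).
  move=> /andP[t0 td].
  have /cvgrPdist_lt /(_ _ t0) [n _ /(_ n (leqnn n))] := acv.
  rewrite /= sub0r normrN gtr0_norm// => ht; exists n => //=.
  by rewrite in_itv/= ht.
have cI : \int[lebesgue_measure]_(t in `]a n, d[) (g t)%:E @[n --> \oo] -->
    \int[lebesgue_measure]_(t in `]0%R, d[) (g t)%:E.
  rewrite -bE; apply: ge0_nondecreasing_set_cvg_integral => //.
  - move=> n m nm; apply/subsetPset => t /=; rewrite !in_itv/= => /andP[ht ->].
    rewrite andbT; apply: le_lt_trans ht.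
    by rewrite ler_wpM2l ?(ltW d0)// lef_pV2 ?posrE// ler_nat !ltnS.
  - move=> n; apply/measurable_EFinP.
    by apply: measurable_funS mg => //; exact: measurable_halfline.
  - by move=> n x _; rewrite lee_fin fine_ge0.
have cP : \int[lebesgue_measure]_(t in `]a n, d[) (g t)%:E @[n --> \oo] -->
    (phi d - lim (phi t @[t --> 0%R^'+]))%:E.
  under eq_cvg do rewrite iE.
  apply: cvg_EFin; first exact: nearW.
  apply: cvgB; first exact: cvg_cst.
  have /cvg_at_rightP := quasi_concave_cvg0 qc; apply; split => //.
by rewrite (cvg_unique _ cI cP)// -EFinD addrC subrK.
Qed.

(** * Dyadic layers *)

(* An enumeration of all powers [2 ^ k], k an integer. *)
Definition dyadic {R : realType} (j : nat) : R :=
  if odd j then (2^-1 ^+ j./2.+1)%R else (2 ^+ j./2)%R.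

(** Meant for a [P] that holds below some height [y] and fails above it: the sum is then a geometric
    series comparable with [y]. *)
Definition layers {R : realType} (P : R -> bool) : \bar R :=
  \sum_(j <oo) (dyadic j * (P (dyadic j))%:R : R)%:E.

Lemma dyadic_gt0 {R : realType} j : (0 < dyadic j :> R)%R.
Proof. by rewrite /dyadic; case: ifP => _; rewrite exprn_gt0. Qed.

Lemma dyadicD {R : realType} j : dyadic j.*2 = (2 ^+ j)%R :> R.
Proof. by rewrite /dyadic odd_double half_double. Qed.

Lemma dyadicS {R : realType} j : dyadic j.*2.+1 = (2^-1 ^+ j.+1)%R :> R.
Proof. by rewrite /dyadic /= odd_double/= uphalf_double. Qed.

Lemma layer_ge0 {R : realType} (P : R -> bool) j :
  0 <= (dyadic j * (P (dyadic j))%:R : R)%:E.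
Proof. by rewrite lee_fin mulr_ge0// ltW// dyadic_gt0. Qed.

Lemma layers_ge0 {R : realType} (P : R -> bool) : 0 <= layers P.
Proof. by apply: nneseries_ge0 => j _ _; exact: layer_ge0. Qed.

Lemma dyadic_layer_le {R : realType} (P : R -> bool) j :
  P (dyadic j) -> (dyadic j : R)%:E <= layers P.
Proof.
move=> Pj; apply: le_trans; last first.
  by apply: (nneseries_lim_ge j.+1) => k _ _; exact: layer_ge0.
rewrite big_nat_recr//= Pj mulr1 leeDr//.
by apply: sume_ge0 => k _; exact: layer_ge0.
Qed.

Lemma dyadic_lt {R : realType} (y : R) :
  (0 < y)%R -> exists j, (dyadic j < y <= 2 * dyadic j)%R.
Proof.
move=> y0; have [y1|y1] := leP y 1%R.
  pose p n := ((2^-1 : R) ^+ n < y)%R.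
  have ex : exists n, p n.
    have h : ((2^-1 : R) ^+ n)%R @[n --> \oo] --> 0%R.
      by apply: cvg_expr; rewrite ger0_norm ?invr_ge0// invf_lt1 ?ltr1n.
    have /cvgrPdist_lt /(_ _ y0) [n _ /(_ n (leqnn n))] := h.
    rewrite /= sub0r normrN ger0_norm ?exprn_ge0 ?invr_ge0// => hn.
    by exists n.
  case: (ex_minnP ex) => -[|n] pn min.
    by move: pn; rewrite /p expr0 ltNge y1.
  exists n.*2.+1; rewrite dyadicS; apply/andP; split; first exact: pn.
  have [|h] := leP y (2^-1 ^+ n)%R.
    by rewrite exprS mulrA divff ?mul1r.
  by have := min n h; rewrite ltnn.
pose p n := (y <= 2 ^+ n)%R.
have ex : exists n, p n.
  exists (Num.bound y); rewrite /p.
  apply: (@le_trans _ _ ((Num.bound y)%:R)%R).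
    by apply/ltW/archi_boundP/ltW.
  by rewrite -natrX ler_nat ltnW// ltn_expl.
case: (ex_minnP ex) => -[|n] pn min.
  by move: pn; rewrite /p expr0 leNgt y1.
exists n.*2; rewrite dyadicD -exprS; apply/andP; split; last exact: pn.
rewrite ltNge; apply/negP => h.
by have := min n h; rewrite ltnn.
Qed.

(** A single level suffices: the largest dyadic number strictly below [y] is at least [y / 2]. For
    [y = +oo] the levels [2 ^ n] are unbounded. *)
Lemma layers_ge {R : realType} (P : R -> bool) (y : \bar R) :
  (forall s, (0 < s)%R -> s%:E < y -> P s) -> y <= 2%:E * layers P.
Proof.
move=> yP; case: y yP => [y| |] yP.
- have [y0|y0] := leP y 0%R.
    by rewrite (@le_trans _ _ 0)// mule_ge0// layers_ge0.
  have [j /andP[jy yj]] := dyadic_lt y0.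
  rewrite (@le_trans _ _ (2%:E * (dyadic j)%:E))//.
  rewrite lee_pmul2l//; apply: dyadic_layer_le.
  by apply: yP => //; exact: dyadic_gt0.
- suff -> : layers P = +oo by rewrite gt0_muley.
  apply/eqyP => A A0; have [n An] : exists n, (A <= 2 ^+ n)%R.
    exists (Num.bound A); apply: (@le_trans _ _ ((Num.bound A)%:R)%R).
      by apply/ltW/archi_boundP/ltW.
    by rewrite -natrX ler_nat ltnW// ltn_expl.
  rewrite (@le_trans _ _ (dyadic n.*2)%:E)// ?lee_fin ?dyadicD//.
  rewrite -dyadicD; apply: dyadic_layer_le.
  by apply: yP; rewrite ?dyadic_gt0 ?ltry.
- by rewrite leNye.
Qed.

(** The levels from 1 upwards and the levels below 1 form two geometric series, each of sum at most
    [2 * y]; hence the 4. *)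
Lemma layers_le {R : realType} (P : R -> bool) (y : \bar R) :
  0 <= y -> (forall s, (0 < s)%R -> P s -> s%:E <= y) ->
  layers P <= 4%:E * y.
Proof.
case: y => [y| |]//; last by move=> _ _; rewrite gt0_muley// leey.
rewrite lee_fin => y0 Py.
pose a j := (dyadic j * (P (dyadic j))%:R : R)%R.
have Pa j : (a j = 0)%R \/ (a j = dyadic j /\ dyadic j <= y)%R.
  rewrite /a; case: (boolP (P (dyadic j))) => Pj; rewrite ?mulr0 ?mulr1.
    by right; split => //; rewrite -lee_fin Py// dyadic_gt0.
  by left.
have up n : (\sum_(k < n) a k.*2 <= 2 ^+ n)%R /\ (\sum_(k < n) a k.*2 <= 2 * y)%R.
  elim: n => [|n [IH1 IH2]]; first by rewrite big_ord0 expr0 mulr_ge0.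
  rewrite big_ord_recr/= exprS.
  have p0 : (0 <= (2 : R) ^+ n)%R by exact: exprn_ge0.
  have [->|[-> jy]] := Pa n.*2; first by rewrite addr0; split => //; lra.
  by move: jy; rewrite dyadicD => jy; split; lra.
(* The reserve [2^-1 ^ n] pays for the next, smaller level; the value 0 covers the stage before a
   first level is met, when the right side may be negative. *)
have dn n : (\sum_(k < n) a k.*2.+1 = 0)%R \/
    (\sum_(k < n) a k.*2.+1 <= 2 * y - 2^-1 ^+ n)%R.
  elim: n => [|n IH]; first by left; rewrite big_ord0.
  rewrite big_ord_recr/=.
  have p0 : (0 <= (2^-1 : R) ^+ n)%R by rewrite exprn_ge0// invr_ge0.
  have [->|[-> jy]] := Pa n.*2.+1.
    case: IH => [->|IH]; [by left; rewrite addr0|right].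
    by rewrite addr0 exprS; lra.
  right; move: jy; rewrite dyadicS exprS => jy.
  by case: IH => [->|IH]; lra.
rewrite -EFinM; apply: lime_le.
  by apply: is_cvg_nneseries => j _ _; exact: layer_ge0.
apply: nearW => n; rewrite (@le_trans _ _ (\sum_(0 <= j < n.*2) (a j)%:E))//.
  rewrite -addnn [leRHS](big_cat_nat _ _ (n := n)) ?leq_addr//= leeDl//.
  by apply: sume_ge0 => j _; exact: layer_ge0.
have -> : \sum_(0 <= j < n.*2) (a j)%:E =
    (\sum_(k < n) a k.*2 + \sum_(k < n) a k.*2.+1)%:E.
  elim: n => [|n IH]; first by rewrite !big_ord0 big_geq// addr0.
  rewrite doubleS 2?big_nat_recr//= IH !big_ord_recr/= -!EFinD.
  by congr _%:E; ring.
rewrite lee_fin; have [_ h1] := up n.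
have p0 : (0 <= (2^-1 : R) ^+ n)%R by rewrite exprn_ge0// invr_ge0.
by have [h2|h2] := dn n; lra.
Qed.

(* [phi] with the value [0] at [0] and its supremum at infinity. *)
Definition ext_phi {R : realType} (phi : R -> R) (d : \bar R) : \bar R :=
  ereal_sup [set (if (0 < t)%R then phi t else 0%R)%:E | t in [set t | t%:E <= d]].

Section ext_phi.
Context {R : realType}.
Variable phi : R -> R.
Hypothesis phi_qc : quasi_concave phi.

Lemma ext_phi_ge0 d : 0 <= d -> 0 <= ext_phi phi d.
Proof.
by move=> d0; apply: ereal_sup_ubound; exists 0%R => //; rewrite ltxx.
Qed.

Lemma ext_phi0 : ext_phi phi 0 = 0.
Proof.
apply/eqP; rewrite eq_le ext_phi_ge0// andbT; apply: ge_ereal_sup.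
by move=> _ [t /= t0 <-]; rewrite ltNge -lee_fin t0.
Qed.

Lemma ext_phi_fin t : (0 < t)%R -> ext_phi phi t%:E = (phi t)%:E.
Proof.
have [phi0 phind _] := phi_qc; move=> t0.
apply/eqP; rewrite eq_le; apply/andP; split.
  apply: ge_ereal_sup => _ [s /= st <-]; rewrite lee_fin.
  by case: ifPn => s0; [exact: phind|exact/ltW/phi0].
by apply: ereal_sup_ubound; exists t => //=; rewrite t0.
Qed.

Lemma ext_phi_ge t d : (0 < t)%R -> t%:E <= d -> (phi t)%:E <= ext_phi phi d.
Proof. by move=> t0 td; apply: ereal_sup_ubound; exists t => //; rewrite t0. Qed.

End ext_phi.

Lemma ext_phi_le_scale {R : realType} (phi psi : R -> R) (C : R) (d : \bar R) :
  (0 <= C)%R -> 0 <= d -> (forall t : R, (0 < t)%R -> (phi t <= C * psi t)%R) ->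
  ext_phi phi d <= C%:E * ext_phi psi d.
Proof.
move=> C0 d0 le; apply: ge_ereal_sup => _ [t /= td <-]; case: ifPn => [t0|_].
  rewrite (@le_trans _ _ (C%:E * (psi t)%:E))//; first by rewrite -EFinM lee_fin le.
  by rewrite lee_wpmul2l//; exact: ext_phi_ge.
by rewrite mule_ge0// ext_phi_ge0.
Qed.

(** * Values of [phi] as integrals of its derivative *)

Definition below {R : realType} (d : \bar R) (t : R) : R := ((t%:E < d)%E)%:R%R.

Lemma measurable_below {R : realType} (d : \bar R) (D : set R) :
  measurable_fun D (below d).
Proof.
have -> : below d = \1_[set t : R | t%:E < d].
  by apply/funext => t; rewrite /below indicE; congr (nat_of_bool _)%:R;
     apply/idP/idP; rewrite inE.
apply: measurable_indic.
rewrite -[X in measurable X]setTI.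
by apply: emeasurable_fun_infty_o => //; exact: measurable_EFin.
Qed.

(** The right side is the mass of [[0, d)] for the measure with an atom [phi(0+)] at 0 and density
    [g]. The strict test [0 < d] drops the atom for a null level set, and [d = +oo] follows by
    monotone convergence. *)
Lemma ext_phi_density {R : realType} (phi : R -> R) (g : R -> \bar R) (d : \bar R) :
  quasi_concave phi ->
  measurable_fun halfline g -> (forall x, 0 <= g x) ->
  (forall d, (0 < d)%R ->
      (lim (phi t @[t --> 0%R^'+]))%:E +
        \int[lebesgue_measure]_(t in `]0%R, d[) g t = (phi d)%:E) ->
  0 <= d ->
  ext_phi phi d = (lim (phi t @[t --> 0%R^'+]))%:E * (((0 < d)%E)%:R)%:E +
    \int[lebesgue_measure]_(t in halfline) ((below d t)%:E * g t).
Proof.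
move=> qc mg g0 dg d0; have [phi0 phind _] := qc.
set l := lim _.
have l0 : (0 <= l)%R by exact: quasi_concave_lim0_ge0.
have finE (r : R) : (0 < r)%R -> \int[lebesgue_measure]_(t in halfline)
    ((below r%:E t)%:E * g t) = \int[lebesgue_measure]_(t in `]0%R, r[) g t.
  move=> r0; rewrite integral_mkcond [RHS]integral_mkcond.
  apply: eq_integral => t _; rewrite !patchE /below lte_fin.
  have [t0|t0] := ltP 0%R t; last first.
    rewrite memNset; last by move=> /halflineE; rewrite ltNge t0.
    by rewrite memNset//= in_itv/= ltNge t0.
  rewrite mem_set; last exact/halflineE.
  have [tr|tr] := ltP t r.
    by rewrite mul1e mem_set//= in_itv/= t0.
  by rewrite mul0e memNset//= in_itv/= t0/= ltNge tr.
case: d d0 => [d| |//]; last first.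
  move=> _; rewrite ltry mule1.
  have -> : \int[lebesgue_measure]_(t in halfline) ((below +oo t)%:E * g t) =
      \int[lebesgue_measure]_(t in halfline) g t.
    by apply: eq_integral => t _; rewrite /below ltry mul1e.
  have cI : \int[lebesgue_measure]_(t in `]0%R, n.+1%:R[) g t @[n --> \oo] -->
      \int[lebesgue_measure]_(t in halfline) g t.
    have -> : @halfline R = \bigcup_n `]0%R, n.+1%:R[%classic.
      apply/seteqP; split=> t.
        move=> /halflineE t0; exists (Num.bound t) => //=.
        rewrite in_itv/= t0/= (@lt_trans _ _ (Num.bound t)%:R)%R ?ltr_nat//.
        by apply/archi_boundP/ltW.
      by move=> [n _]/=; rewrite in_itv/= => /andP[t0 _]; exact/halflineE.
    apply: ge0_nondecreasing_set_cvg_integral => //.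
    - move=> n m nm; apply/subsetPset => t /=; rewrite !in_itv/= => /andP[->]/=.
      by move=> /lt_le_trans; apply; rewrite ler_nat ltnS.
    - move=> n; apply: measurable_funS mg => //; first exact: measurable_halfline.
      by move=> t /=; rewrite in_itv/= => /andP[t0 _]; apply/halflineE.
  have nE n :
      \int[lebesgue_measure]_(t in `]0%R, n.+1%:R[) g t = (phi n.+1%:R - l)%:E.
    rewrite EFinB -dg// addeAC subee ?add0e//.
  have le1 : \int[lebesgue_measure]_(t in halfline) g t <= ext_phi phi +oo - l%:E.
    apply: (cvge_le _ cI); apply: nearW => n.
    rewrite nE EFinB leeB//; apply: ext_phi_ge => //; exact: leey.
  apply/eqP; rewrite eq_le; apply/andP; split; last first.
    rewrite addeC -leeBrDr//.
  apply: ge_ereal_sup => _ [t _ <-].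
  have [t0|t0] := ltP 0%R t; last first.
    by rewrite adde_ge0 ?lee_fin//; apply: integral_ge0.
  rewrite -dg// leeD2l//; apply: ge0_subset_integral => //.
  - exact: measurable_halfline.
  - by move=> x /=; rewrite in_itv/= => /andP[x0 _]; apply/halflineE.
rewrite lee_fin le_eqVlt => /predU1P[<-|d0]; last first.
  by rewrite finE// lte_fin d0 mule1 dg// ext_phi_fin.
rewrite ext_phi0 ltxx mule0 add0e.
rewrite integral0_eq// => t /halflineE t0.
by rewrite /below lte_fin ltNge (ltW t0) mul0e.
Qed.

(** * Distribution function, rearrangement and sup norm *)

Section distribution.
Context {R : realType}.
Variable f : R -> \bar R.
Hypothesis mf : measurable_fun halfline f.

Lemma measurable_level s : measurable [set x | halfline x /\ s%:E < `|f x|].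
Proof.
apply: (@emeasurable_fun_o_infty _ _ _ halfline (abse \o f)).
  exact: measurable_halfline.
exact: measurableT_comp.
Qed.

Lemma distr_ge0 s : 0 <= distr f s.
Proof. exact: measure_ge0. Qed.

Lemma le_distr s t : (s <= t)%R -> distr f t <= distr f s.
Proof.
move=> st; apply: le_measure; rewrite ?inE; [exact: measurable_level..|].
by move=> x [x0 ?]; split => //; rewrite (le_lt_trans _ _ (y := t%:E)).
Qed.

(** Together with [le_rearr]: up to equality, [rearr f t] exceeds exactly the heights at which the
    distribution exceeds [t]. The strict and weak signs are those that [layers_ge] and [layers_le]
    take. *)
Lemma lt_rearr s t : (0 <= s)%R -> s%:E < rearr f t -> t%:E < distr f s.
Proof.
move=> s0; rewrite !ltNge; apply: contra => dst.
by apply: ereal_inf_lbound; exists s.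
Qed.

Lemma le_rearr s t : t%:E < distr f s -> s%:E <= rearr f t.
Proof.
move=> tds; apply/ereal_infP => _ [r [r0 drt] <-]; rewrite lee_fin leNgt.
apply/negP => rs; have := le_lt_trans drt tds.
by rewrite ltNge le_distr// ltW.
Qed.

Lemma rearr_ge0 t : 0 <= rearr f t.
Proof. by apply/ereal_infP => _ [r [r0 _] <-]; rewrite lee_fin. Qed.

(** The sup norm plays the part of the rearrangement at [t = 0], where the atom [phi(0+)] sits. *)
Lemma lt_Linfty s : (0 <= s)%R ->
  s%:E < 'N[@lebesgue_measure R]_+oo[f \_ halfline] -> 0 < distr f s.
Proof.
(* The unfolded sup norm is 0 by convention on a space of measure 0, hence the case split. *)
move=> s0; rewrite unlock; case: ifPn => [_|_]; last first.
  by rewrite ltNge lee_fin s0.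
rewrite lt0e distr_ge0 andbT; apply: contraTN => /eqP ds.
rewrite -leNgt; apply/ess_supP.
exists [set x | halfline x /\ s%:E < `|f x|]; split => //.
  exact: measurable_level.
move=> x /= /negP; rewrite -ltNge patchE; case: ifPn => [/set_mem hx sx|_].
  by split.
by rewrite abse0 lte_fin ltNge s0.
Qed.

Lemma le_Linfty s : 0 < distr f s ->
  s%:E <= 'N[@lebesgue_measure R]_+oo[f \_ halfline].
Proof.
rewrite unlock; case: ifPn => [_|]; last first.
  rewrite -leNgt => h; rewrite lt0e => /andP[/negP ds _].
  exfalso; apply: ds; rewrite eq_le distr_ge0 andbT; apply: le_trans h.
  by apply: le_measure; rewrite ?inE//; exact: measurable_level.
move=> ds; rewrite leNgt; apply/negP => sN.
have := ess_sup_ge lebesgue_measure (abse \o f \_ halfline).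
move=> [N [mN N0 sub]]; move: ds; rewrite lt0e => /andP[/negP + _]; apply.
rewrite eq_le distr_ge0 andbT -N0; apply: le_measure; rewrite ?inE//.
  exact: measurable_level.
move=> x [hx sx]; apply: sub => /=; rewrite patchE mem_set//.
by apply/negP; rewrite -ltNge (lt_trans sN).
Qed.

End distribution.

(** * The Lorentz norm as a dyadic sum *)

(** A discretised [\int_0^oo phi (distr f s) ds], the layer-cake form of the Lorentz norm. Since it
    contains values of [phi] only, it is monotone in [phi]. *)
Definition dyadic_sum {R : realType} (phi : R -> R) (f : R -> \bar R) : \bar R :=
  \sum_(j <oo) (dyadic j : R)%:E * ext_phi phi (distr f (dyadic j)).

(** Each [ext_phi] is an atom plus an integral over [t] of an indicator, so Tonelli exchanges
    integral and sum and collects, for each [t], the levels whose distribution exceeds [t]. *)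
Lemma dyadic_sum_density {R : realType} (phi : R -> R) (g : R -> R)
    (f : R -> \bar R) :
  quasi_concave phi -> measurable_fun halfline f ->
  measurable_fun halfline g -> (forall x, (0 <= g x)%R) ->
  (forall d, (0 < d)%R ->
      (lim (phi t @[t --> 0%R^'+]))%:E +
        \int[lebesgue_measure]_(t in `]0%R, d[) (g t)%:E = (phi d)%:E) ->
  dyadic_sum phi f =
    (lim (phi t @[t --> 0%R^'+]))%:E * layers (fun s => 0 < distr f s) +
    \int[lebesgue_measure]_(t in halfline)
      (layers (fun s => (t%:E < distr f s)%E) * (g t)%:E).
Proof.
move=> qc mf mg g0 dg; set l := lim _.
have l0 : (0 <= l)%R by exact: quasi_concave_lim0_ge0.
pose u j t : \bar R := (dyadic j * below (distr f (dyadic j)) t)%:E * (g t)%:E.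
have b0 d t : (0 <= below d t :> R)%R by [].
have u0 j t : 0 <= u j t.
  by rewrite /u mule_ge0 ?lee_fin// mulr_ge0// ltW// dyadic_gt0.
have mu_ j : measurable_fun halfline (u j).
  apply: emeasurable_funM; last exact/measurable_EFinP.
  apply/measurable_EFinP; by apply: measurable_funM => //; exact: measurable_below.
have -> : dyadic_sum phi f =
    \sum_(j <oo) (l%:E * (dyadic j * ((0 < distr f (dyadic j))%E)%:R)%:E +
      \int[lebesgue_measure]_(t in halfline) u j t).
  apply: eq_eseriesr => j _.
  have mg' : measurable_fun halfline (EFin \o g) by exact/measurable_EFinP.
  rewrite (ext_phi_density qc mg' g0 dg) ?distr_ge0// -/l.
  rewrite ge0_muleDr ?mule_ge0 ?lee_fin//; last first.
    by apply: integral_ge0 => t _; rewrite mule_ge0 ?lee_fin.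
  congr (_ + _).
    by rewrite -!EFinM; congr _%:E; ring.
  rewrite -ge0_integralZl//.
  - by apply: eq_integral => t _; rewrite /u EFinM muleA.
  - exact: measurable_halfline.
  - apply: emeasurable_funM; apply/measurable_EFinP => //.
    exact: measurable_below.
  - by move=> t _; rewrite mule_ge0 ?lee_fin.
  - by rewrite lee_fin ltW// dyadic_gt0.
pose v j : \bar R := l%:E * (dyadic j * ((0 < distr f (dyadic j))%E)%:R)%:E.
rewrite (@nneseriesD R v
  (fun j => \int[lebesgue_measure]_(t in halfline) u j t))//; last 2 first.
- move=> j _ _; apply: mule_ge0; first by rewrite lee_fin.
  exact: (layer_ge0 (fun s => (0 < distr f s)%E)).
- by move=> j _ _; exact: integral_ge0.
congr (_ + _).
  rewrite nneseriesZl//= => j _.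
  exact: (layer_ge0 (fun s => (0 < distr f s)%E)).
rewrite -integral_nneseries//; last exact: measurable_halfline.
apply: eq_integral => t _; rewrite /layers /u.
rewrite muleC -nneseriesZl//=; last first.
  by move=> j _; exact: (layer_ge0 (fun s => (t%:E < distr f s)%E)).
by apply: eq_eseriesr => j _; rewrite muleC.
Qed.

Lemma Lorentz_norm_dyadic {R : realType} (phi : R -> R) (f : R -> \bar R) :
  quasi_concave phi -> measurable_fun halfline f ->
  Lorentz_norm phi f <= 2%:E * dyadic_sum phi f /\
  dyadic_sum phi f <= 4%:E * Lorentz_norm phi f.
Proof.
move=> qc mf; have [g [mg g0 ag dg]] := quasi_concave_derivative qc.
rewrite (dyadic_sum_density qc mf mg g0 dg) /Lorentz_norm; set l := lim _.
have l0 : 0 <= l%:E by rewrite lee_fin; exact: quasi_concave_lim0_ge0.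
have -> : \int[lebesgue_measure]_(t in halfline) (rearr f t * (derive1 phi t)%:E) =
    \int[lebesgue_measure]_(t in halfline) (rearr f t * (g t)%:E).
  by apply: ae_eq_integralW; apply: ae_lebesgueS ag => x gx /gx ->.
pose L t := layers (fun s => (t%:E < distr f s)%E).
have mL : measurable_fun halfline L.
  apply: (@ge0_emeasurable_sum _ _ _ _ (fun j t =>
    (dyadic j * below (distr f (dyadic j)) t)%:E) xpredT) => [j t _ _|j _].
    by rewrite lee_fin mulr_ge0// ltW// dyadic_gt0.
  by apply/measurable_EFinP/measurable_funM => //; exact: measurable_below.
pose h t := L t * (g t)%:E.
have mh : measurable_fun halfline h.
  by apply: emeasurable_funM => //; exact/measurable_EFinP.
have h0 t : 0 <= h t by rewrite mule_ge0 ?layers_ge0 ?lee_fin.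
have r0 t : 0 <= rearr f t * (g t)%:E by rewrite mule_ge0 ?rearr_ge0 ?lee_fin.
have i0 : 0 <= \int[lebesgue_measure]_(t in halfline) h t by exact: integral_ge0.
have j0 : 0 <= \int[lebesgue_measure]_(t in halfline) (rearr f t * (g t)%:E).
  exact: integral_ge0.
have ZE k : (0 <= k)%R ->
    k%:E * \int[lebesgue_measure]_(t in halfline) h t =
    \int[lebesgue_measure]_(t in halfline) (k%:E * h t).
  move=> k0; rewrite ge0_integralZl//; exact: measurable_halfline.
have rL t : rearr f t <= 2%:E * L t.
  by apply: layers_ge => s s0; exact/lt_rearr/ltW.
have Lr t : L t <= 4%:E * rearr f t.
  by apply: layers_le => [|s s0]; [exact: rearr_ge0|exact: le_rearr].
have ilt (u v : R -> \bar R) : (forall t, 0 <= u t) -> (forall t, 0 <= v t) ->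
    (forall t, u t <= v t) ->
    \int[lebesgue_measure]_(t in halfline) u t <=
    \int[lebesgue_measure]_(t in halfline) v t.
  move=> u0 v0 uv; rewrite integral_mkcond [leRHS]integral_mkcond.
  apply: ge0_le_integral_ae => [x|x|]; [exact: erestrict_ge0..|].
  by apply: aeW => x; rewrite !patchE; case: ifP.
split.
  rewrite ge0_muleDr ?mule_ge0 ?layers_ge0//; apply: leeD.
    rewrite muleCA lee_wpmul2l//.
    by apply: layers_ge => s s0; exact/lt_Linfty/ltW.
  rewrite ZE//.
  apply: ilt => // [t|t]; first by rewrite mule_ge0 ?h0.
  by rewrite muleA lee_wpmul2r// lee_fin.
rewrite ge0_muleDr ?mule_ge0 ?Lnorm_ge0//; apply: leeD.
  rewrite muleCA lee_wpmul2l//.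
  by apply: layers_le => [|s s0]; [exact: Lnorm_ge0|exact: le_Linfty].
(* The factor 4 is carried over to [h], whose measurability is known, instead of being taken out of
   the integral with [rearr f]. *)
have k0 : (0 <= 4^-1 :> R)%R by rewrite invr_ge0.
rewrite -lee_pdivrMl// ZE//.
apply: ilt => // t; first by rewrite mule_ge0 ?h0// lee_fin.
by rewrite /h muleA lee_wpmul2r ?lee_fin// lee_pdivrMl.
Qed.

Lemma dyadic_sum_le_scale {R : realType} (phi psi : R -> R) (C : R) f :
  (0 <= C)%R -> (forall t : R, (0 < t)%R -> (phi t <= C * psi t)%R) ->
  dyadic_sum phi f <= C%:E * dyadic_sum psi f.
Proof.
move=> C0 le.
have c0 (j : nat) : 0 <= (dyadic j : R)%:E by rewrite lee_fin ltW// dyadic_gt0.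
have e0 (p : R -> R) j : 0 <= (dyadic j : R)%:E * ext_phi p (distr f (dyadic j)).
  by rewrite mule_ge0 ?ext_phi_ge0 ?distr_ge0.
rewrite /dyadic_sum -nneseriesZl//; apply: lee_nneseries => j *; first exact: e0.
by rewrite muleCA lee_wpmul2l// ext_phi_le_scale ?distr_ge0.
Qed.

Lemma Lorentz_norm_le_scale {R : realType} (phi psi : R -> R) (C : R) f :
  quasi_concave phi -> quasi_concave psi -> measurable_fun halfline f ->
  (0 <= C)%R -> (forall t : R, (0 < t)%R -> (phi t <= C * psi t)%R) ->
  Lorentz_norm phi f <= (8 * C)%:E * Lorentz_norm psi f.
Proof.
move=> qphi qpsi mf C0 le; have [h1 _] := Lorentz_norm_dyadic qphi mf.
have [_ h2] := Lorentz_norm_dyadic qpsi mf.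
apply: (le_trans h1); rewrite (_ : 8 * C = 2 * (C * 4))%R; last by ring.
rewrite EFinM -muleA lee_wpmul2l// (le_trans (dyadic_sum_le_scale f C0 le))//.
by rewrite EFinM -muleA lee_wpmul2l.
Qed.

Lemma Lorentz_space_eq {R : realType} (phi psi : R -> R) (C D : R) :
  quasi_concave phi -> quasi_concave psi -> (0 < C)%R -> (0 < D)%R ->
  (forall t : R, (0 < t)%R -> (phi t <= C * psi t)%R) ->
  (forall t : R, (0 < t)%R -> (psi t <= D * phi t)%R) ->
  space_eq (Lorentz phi) (Lorentz psi).
Proof.
move=> qphi qpsi C0 D0 le1 le2.
have l1 (f : R -> \bar R) (mf : measurable_fun halfline f) :=
  Lorentz_norm_le_scale qphi qpsi mf (ltW C0) le1.
have l2 (f : R -> \bar R) (mf : measurable_fun halfline f) :=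
  Lorentz_norm_le_scale qpsi qphi mf (ltW D0) le2.
have fin (c : R) x y : (0 < c)%R -> y <= (8 * c)%:E * x -> x < +oo -> y < +oo.
  move=> c0 /le_lt_trans yx xoo; apply: yx.
  by rewrite lte_mul_pinfty// lee_fin mulr_ge0// ltW.
split=> [f|].
  split=> -[mf foo]; (split; first exact: mf).
    exact: (fin D _ _ D0 (l2 f mf) foo).
  exact: (fin C _ _ C0 (l1 f mf) foo).
exists (8 * C)^-1%R, (8 * D)%R; split; rewrite ?invr_gt0 ?mulr_gt0//.
move=> f [mf _]; apply/andP; split; last exact: l2.
by rewrite lee_pdivrMl ?mulr_gt0//; exact: l1.
Qed.

Section indicator.
Context {R : realType}.
Variable E : set R.
Hypotheses (mE : measurable E) (E0 : E `<=` halfline).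

Lemma distr_indic s : (0 <= s)%R ->
  distr (fun x => (\1_E x)%:E) s = if (s < 1)%R then lebesgue_measure E else 0.
Proof.
move=> s0; rewrite /distr; case: ifPn => s1.
  congr lebesgue_measure; apply/seteqP; split=> x /=.
    move=> [_]; rewrite indicE; case: (boolP (x \in E)) => [/set_mem//|_].
    by rewrite /= normr0 lte_fin ltNge s0.
  move=> Ex; split; first exact: E0.
  by rewrite indicE mem_set//= normr1 lte_fin.
rewrite [X in lebesgue_measure X](_ : _ = set0) ?measure0//.
apply/seteqP; split=> x //= [_]; rewrite indicE lte_fin ger0_norm//.
by case: (x \in E); rewrite ltNge ?s0// leNgt s1.
Qed.

(** The level sets of the indicator are [E] below height 1 and empty from there on, so its dyadic
    sum is [phi t] times the sum of the levels below 1, which is between 1/2 and 4. The factors 4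
    and 2 of [Lorentz_norm_dyadic] turn these bounds into 1/8 and 8. *)
Lemma Lorentz_norm_indic (phi : R -> R) (t : R) :
  quasi_concave phi -> (0 < t)%R -> lebesgue_measure E = t%:E ->
  (8^-1 * phi t)%:E <= Lorentz_norm phi (fun x => (\1_E x)%:E) <= (8 * phi t)%:E.
Proof.
move=> qc t0 Et; have [phi0 _ _] := qc.
set f := fun x => (\1_E x)%:E.
have mf : measurable_fun halfline f by exact/measurable_EFinP/measurable_indic.
have [h1 h2] := Lorentz_norm_dyadic qc mf.
pose P (s : R) := (s < 1)%R.
have P1 : 1 <= 2%:E * layers P by apply: layers_ge => s s0; rewrite lte_fin.
have P4 : layers P <= 4%:E.
  rewrite -[leRHS]mule1; apply: layers_le => // s s0 s1.
  by rewrite lee_fin ltW.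
have dE : dyadic_sum phi f = (phi t)%:E * layers P.
  rewrite /layers -nneseriesZl; last by move=> j _; exact: layer_ge0.
  apply: eq_eseriesr => j _; rewrite distr_indic ?ltW ?dyadic_gt0//.
  rewrite /P; case: ifPn => j1; last by rewrite ext_phi0 !mulr0 !mule0.
  by rewrite Et ext_phi_fin// mulr1 muleC.
have pt : 0 <= (phi t)%:E by rewrite lee_fin ltW// phi0.
rewrite dE in h1 h2; apply/andP; split.
  rewrite EFinM lee_pdivrMl// (_ : 8 = 2 * 4)%R; last by ring.
  rewrite EFinM -muleA (le_trans _ (lee_wpmul2l _ h2))//.
  by rewrite muleCA -[leLHS]mule1 lee_wpmul2l.
apply: (le_trans h1); rewrite (_ : 8 * phi t = 2 * (phi t * 4))%R; last by ring.
by rewrite EFinM lee_wpmul2l// EFinM lee_wpmul2l.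
Qed.

End indicator.

(** * Rearrangement invariant norms *)

Section ri_norm.
Context {R : realType}.
Variable rho : (R -> \bar R) -> \bar R.
Hypothesis rhoP : is_ri_norm rho.

Lemma halfline_ae (P : R -> Prop) : (forall x, halfline x -> P x) -> ae_halfline P.
Proof. by move=> h; apply: aeW. Qed.

Lemma rho_leW f g : Mplus f -> Mplus g -> (forall x, halfline x -> f x <= g x) ->
  rho f <= rho g.
Proof. by move=> mf mg fg; apply: (rho_le rhoP) => //; exact: halfline_ae. Qed.

Lemma rho_eqW f g : Mplus f -> Mplus g -> (forall x, halfline x -> f x = g x) ->
  rho f = rho g.
Proof.
by move=> mf mg fg; apply/eqP; rewrite eq_le !rho_leW// => x /fg ->.
Qed.

Lemma MplusZ (a : R) (f : R -> \bar R) : (0 <= a)%R -> Mplus f ->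
  Mplus (fun x => a%:E * f x).
Proof.
move=> a0 [mf f0]; split; first exact: measurable_funeM.
by move=> x hx; rewrite mule_ge0 ?f0.
Qed.

Lemma Mplus_cst (a : \bar R) : 0 <= a -> Mplus (fun _ : R => a).
Proof. by move=> a0; split => // x. Qed.

Lemma rho0 : rho (fun=> 0) = 0.
Proof. by apply/(rho_eq0 rhoP); [exact: Mplus_cst|exact: halfline_ae]. Qed.

Lemma Mplus_sum (h : nat -> R -> \bar R) n : (forall j, Mplus (h j)) ->
  Mplus (fun x => \sum_(0 <= j < n) h j x).
Proof.
move=> mh; split; first by apply: emeasurable_sum => j; have [] := mh j.
by move=> x hx; apply: sume_ge0 => j _; have [_ ->] := mh j.
Qed.

Lemma Mplus_nneseries (h : nat -> R -> \bar R) : (forall j, Mplus (h j)) ->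
  Mplus (fun x => \sum_(j <oo) h j x).
Proof.
move=> mh; have h0 j x : halfline x -> 0 <= h j x by have [_] := mh j; exact.
split; last by move=> x hx; apply: nneseries_ge0 => j *; exact: h0.
apply: (@ge0_emeasurable_sum _ _ _ _ h xpredT) => [j x hx _|j _]; first exact: h0.
by have [] := mh j.
Qed.

(** Subadditivity handles the partial sums, the Fatou property their increasing limit. *)
Lemma rho_nneseries (h : nat -> R -> \bar R) : (forall j, Mplus (h j)) ->
  rho (fun x => \sum_(j <oo) h j x) <= \sum_(j <oo) rho (h j).
Proof.
move=> mh; pose s n x := \sum_(0 <= j < n) h j x.
have ms n : Mplus (s n) by exact: Mplus_sum.
have h0 j x : halfline x -> 0 <= h j x by have [_] := mh j; exact.
have sle n : rho (s n) <= \sum_(0 <= j < n) rho (h j).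
  elim: n => [|n IH].
    rewrite big_geq// (_ : s 0%N = fun=> 0) ?rho0//.
    by apply/funext => x; rewrite /s big_geq.
  rewrite big_nat_recr//= (_ : s n.+1 = fun x => s n x + h n x); last first.
    by apply/funext => x; rewrite /s big_nat_recr.
  by rewrite (le_trans (rhoD rhoP (ms n) (mh n)))// leeD2r.
have [|_ cs] := rho_fatou rhoP ms (Mplus_nneseries mh).
  apply: halfline_ae => x hx; split => [n|].
    by rewrite /s big_nat_recr//= leeDl// h0.
  by apply: is_cvg_nneseries => j _ _; exact: h0.
apply: (cvge_le _ cs); apply: nearW => n; apply: (le_trans (sle n)).
by apply: nneseries_lim_ge => j _ _; exact: (rho_ge0 rhoP).
Qed.

Lemma scale_ri_norm (c : R) : (0 < c)%R -> is_ri_norm (fun f => c%:E * rho f).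
Proof.
move=> c0; have c0' : 0 <= c%:E by rewrite lee_fin ltW.
split.
- by move=> f mf; rewrite mule_ge0// (rho_ge0 rhoP).
- move=> f mf; rewrite -(rho_eq0 rhoP mf); split; last by move=> ->; rewrite mule0.
  by move=> /eqP; rewrite mule_eq0 eqe (gt_eqF c0)/= => /eqP.
- by move=> a f a0 mf; rewrite (rhoZ rhoP a0 mf) muleCA.
- move=> f g mf mg; rewrite -ge0_muleDr ?(rho_ge0 rhoP)// lee_wpmul2l//.
  exact: (rhoD rhoP).
- by move=> f g mf mg fg; rewrite lee_wpmul2l// (rho_le rhoP).
- move=> u f mu mf uf; have [h1 h2] := rho_fatou rhoP mu mf uf.
  by split=> [n|]; [rewrite lee_wpmul2l|exact: cvgeZl].
- move=> E mE E0 Efin; rewrite lte_mul_pinfty//; exact: (rho_indic rhoP).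
- move=> E mE E0 Efin; have [C C0 h] := rho_int rhoP mE E0 Efin.
  exists (C / c)%R; first by rewrite divr_gt0.
  move=> f mf; rewrite muleA -EFinM divfK ?gt_eqF//; exact: h.
- by move=> f g mf mg fin1 fin2 eq; rewrite (rho_ri rhoP mf mg).
Qed.

End ri_norm.

Definition sup_rho {R : realType} (F : set (riSpace R)) (f : R -> \bar R) : \bar R :=
  ereal_sup [set ri_rho Z f | Z in F].

Lemma sup_rho_ge {R : realType} (F : set (riSpace R)) Z f :
  F Z -> ri_rho Z f <= sup_rho F f.
Proof. by move=> FZ; apply: ereal_sup_ubound; exists Z. Qed.

Lemma sup_rho_le {R : realType} (F : set (riSpace R)) f (M : \bar R) :
  (forall Z, F Z -> ri_rho Z f <= M) -> sup_rho F f <= M.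
Proof. by move=> h; apply: ge_ereal_sup => _ [Z FZ <-]; exact: h. Qed.

(** One member of the family gives definiteness and local integrability; the uniform bound on
    indicators keeps the supremum finite there. The Fatou property survives because two suprema
    commute. *)
Lemma sup_ri_norm {R : realType} (F : set (riSpace R)) : F !=set0 ->
  (forall E : set R, measurable E -> E `<=` halfline -> lebesgue_measure E < +oo ->
    exists M : R, forall Z, F Z -> ri_rho Z (fun x => (\1_E x)%:E) <= M%:E) ->
  is_ri_norm (sup_rho F).
Proof.
move=> [Z0 FZ0] Fbnd; have P (Z : riSpace R) := ri_rhoP Z.
have ge0 f : Mplus f -> 0 <= sup_rho F f.
  by move=> mf; rewrite (le_trans _ (sup_rho_ge f FZ0))// (rho_ge0 (P Z0)).
have sle f g : Mplus f -> Mplus g -> ae_halfline (fun x => g x <= f x) ->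
    sup_rho F g <= sup_rho F f.
  move=> mf mg gf; apply: sup_rho_le => Z FZ.
  by rewrite (le_trans _ (sup_rho_ge f FZ))// (rho_le (P Z)).
split => //.
- move=> f mf; split=> [f0|f0].
    apply/(rho_eq0 (P Z0) mf)/eqP; rewrite eq_le (rho_ge0 (P Z0) mf) andbT -f0.
    exact: sup_rho_ge.
  apply/eqP; rewrite eq_le ge0// andbT; apply: sup_rho_le => Z FZ.
  by have [_ ->] := rho_eq0 (P Z) mf.
- move=> a f a0 mf; apply/eqP; rewrite eq_le; apply/andP; split.
    apply: sup_rho_le => Z FZ; rewrite (rhoZ (P Z))// lee_wpmul2l//.
    exact: sup_rho_ge.
  have [a00|an0] := eqVneq a 0%R.
    by rewrite a00 mul0e ge0//; exact: MplusZ.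
  have {an0} a1 : (0 < a)%R by rewrite lt_neqAle eq_sym an0.
  rewrite -lee_pdivlMl//; apply: sup_rho_le => Z FZ.
  rewrite lee_pdivlMl// -(rhoZ (P Z) (ltW a1) mf).
  exact: sup_rho_ge.
- move=> f g mf mg; apply: sup_rho_le => Z FZ.
  rewrite (le_trans (rhoD (P Z) mf mg))// leeD//; exact: sup_rho_ge.
- move=> u f mu mf uf; have und n : sup_rho F (u n) <= sup_rho F (u n.+1).
    by apply: sle => //; apply: ae_lebesgueS uf => x uf /uf[].
  split => //.
  have nd : nondecreasing_seq (fun n => sup_rho F (u n)).
    exact/nondecreasing_seqP.
  have cs := ereal_nondecreasing_cvgn nd.
  suff -> : sup_rho F f = ereal_sup (range (fun n => sup_rho F (u n))) by [].
  apply/eqP; rewrite eq_le; apply/andP; split.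
    apply: sup_rho_le => Z FZ; have [_ h] := rho_fatou (P Z) mu mf uf.
    apply: (cvge_le _ h); apply: nearW => n.
    apply: (le_trans (sup_rho_ge (u n) FZ)).
    by apply: ereal_sup_ubound; exists n.
  apply: ge_ereal_sup => _ [n _ <-]; apply: sup_rho_le => Z FZ.
  apply: (le_trans _ (sup_rho_ge f FZ)).
  have [nd' h] := rho_fatou (P Z) mu mf uf.
  have /ereal_nondecreasing_cvgn h' : nondecreasing_seq (fun n => ri_rho Z (u n)).
    exact/nondecreasing_seqP.
  rewrite (cvg_unique _ h h')//.
  by apply: ereal_sup_ubound; exists n.
- move=> E mE E0 Efin; have [M h] := Fbnd E mE E0 Efin.
  by rewrite (le_lt_trans (sup_rho_le h))// ltry.
- move=> E mE E0 Efin; have [C C0 h] := rho_int (P Z0) mE E0 Efin.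
  exists C => // f mf; apply: (le_trans (h f mf)).
  by apply: lee_wpmul2l; [rewrite lee_fin ltW|exact: sup_rho_ge].
- move=> f g mf mg f1 g1 fg; rewrite /sup_rho; congr ereal_sup.
  by apply: eq_imagel => Z FZ; exact: (rho_ri (P Z)).
Qed.

(** * The Hardy operator on Lorentz spaces *)

Lemma ndecr_halfline_emeasurable {R : realType} (u : R -> \bar R) :
  (forall s t : R, (0 < s)%R -> (s <= t)%R -> u s <= u t) ->
  measurable_fun halfline u.
Proof.
move=> und mD; apply: (measurability _ (ErealGenCInfty.measurableE R)) => //.
move=> _ [_ [x ->] <-]; rewrite preimage_itvcy; apply: is_interval_measurable.
move=> s t /= [/halflineE s0 xs] [_ _] r /andP[sr _]; split.
  exact/halflineE/(lt_le_trans s0 sr).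
by rewrite /= (le_trans xs)// und.
Qed.

Section Hardy.
Context {R : realType}.
Implicit Types f : R -> \bar R.

Lemma itv0_halfline (t : R) : `]0%R, t[%classic `<=` halfline.
Proof. by move=> x /=; rewrite in_itv/= => /andP[x0 _]; exact/halflineE. Qed.

Lemma measurable_itv0 f (t : R) : measurable_fun halfline f ->
  measurable_fun `]0%R, t[%classic f.
Proof.
by apply: measurable_funS; [exact: measurable_halfline|exact: itv0_halfline].
Qed.

Lemma measurable_Hardy f : measurable_fun halfline f ->
  measurable_fun halfline (Hardy f).
Proof.
move=> mf.
have mint (g : R -> \bar R) : measurable_fun halfline g ->
    (forall x, 0 <= g x) ->
    measurable_fun halfline (fun t => \int[lebesgue_measure]_(r in `]0%R, t[) g r).
  move=> mg g0; apply: ndecr_halfline_emeasurable => s t s0 st.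
  apply: ge0_subset_integral => //; first exact: measurable_itv0.
  by apply: subset_itvl; rewrite bnd_simp.
apply: emeasurable_funM.
  apply/measurable_EFinP; apply: nincr_halfline_measurable => s t s0 st.
  by rewrite lef_pV2// posrE (lt_le_trans s0).
rewrite (_ : (fun t => _) = (fun t : R =>
    \int[lebesgue_measure]_(r in `]0%R, t[) f^\+ r -
    \int[lebesgue_measure]_(r in `]0%R, t[) f^\- r)); last first.
  by apply/funext => t; rewrite integralE.
apply: emeasurable_funB; apply: mint => //.
  exact: measurable_funepos.
exact: measurable_funeneg.
Qed.

Lemma Hardy_ge0 f (t : R) : (0 < t)%R -> (forall x, 0 <= f x) -> 0 <= Hardy f t.
Proof.
move=> t0 f0; apply: mule_ge0; first by rewrite lee_fin invr_ge0 ltW.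
exact: integral_ge0.
Qed.

Lemma Hardy_indic (E : set R) (t : R) : measurable E ->
  Hardy (fun x => (\1_E x)%:E) t = (t^-1)%:E * lebesgue_measure (E `&` `]0%R, t[).
Proof. by move=> mE; rewrite /Hardy integral_indic. Qed.

Definition level f (s : R) : set R := [set x | halfline x /\ s%:E < `|f x|].

(** The layers of [|f|] add up to at least [|f| / 2], and the Hardy operator commutes with series of
    nonnegative functions; this reduces its estimate to indicators. *)
Lemma abse_Hardy_le f (t : R) : measurable_fun halfline f -> (0 < t)%R ->
  `|Hardy f t| <= 2%:E * \sum_(j <oo) (dyadic j : R)%:E *
     Hardy (fun x => (\1_(level f (dyadic j)) x)%:E) t.
Proof.
move=> mf t0; pose E j := level f (dyadic j).
have mE j : measurable (E j) by exact: measurable_level.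
have mD : measurable (`]0%R, t[%classic : set R) by [].
have ti : (0 <= t^-1)%R by rewrite invr_ge0 ltW.
pose c (j : nat) : R := dyadic j.
have c0 j : (0 <= c j)%R by rewrite ltW// dyadic_gt0.
pose h j x : \bar R := (c j)%:E * (\1_(E j) x)%:E.
have h0 j x : 0 <= h j x by rewrite mule_ge0// lee_fin.
have ma : measurable_fun `]0%R, t[%classic (fun x => `|f x|).
  by apply: measurableT_comp => //; exact: measurable_itv0.
have m1 j : measurable_fun `]0%R, t[%classic (fun x => (\1_(E j) x : R)%:E).
  by apply/measurable_EFinP; exact: measurable_indic.
have mh j : measurable_fun `]0%R, t[%classic (h j).
  exact: measurable_funeM.
have -> : 2%:E * \sum_(j <oo) (dyadic j)%:E * Hardy (fun x => (\1_(E j) x)%:E) t =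
    (t^-1)%:E * \int[lebesgue_measure]_(x in `]0%R, t[)
      (2%:E * \sum_(j <oo) h j x).
  rewrite ge0_integralZl//; last 2 first.
  - apply: (@ge0_emeasurable_sum _ _ _ _ h xpredT) => //.
  - by move=> x _; exact: nneseries_ge0.
  rewrite muleCA; congr (_ * _); rewrite integral_nneseries// -nneseriesZl//.
    apply: eq_eseriesr => j _; rewrite /Hardy /h muleCA; congr (_ * _).
    rewrite ge0_integralZl//; last by rewrite lee_fin.
    exact: m1.
  by move=> j _; exact: integral_ge0.
rewrite /Hardy abseM gee0_abs ?lee_fin// lee_wpmul2l ?lee_fin//.
apply: le_trans (le_abse_integral _ _ _) _ => //; first exact: measurable_itv0.
apply: ge0_le_integral => //.
  by apply: measurable_funeM; apply: (@ge0_emeasurable_sum _ _ _ _ h xpredT).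
move=> x /itv0_halfline hx.
have -> : \sum_(j <oo) h j x = layers (fun s => (s%:E < `|f x|)%E).
  apply: eq_eseriesr => j _; rewrite /h -EFinM indicE /c.
  congr (_ * (nat_of_bool _)%:R)%:E; apply/idP/idP; first by move=> /set_mem[].
  by move=> ?; apply: mem_set.
by apply: layers_ge => s s0.
Qed.

End Hardy.

(** * Finiteness and quasi-concavity of [W] *)

Section W.
Context {R : realType}.
Variable X : riSpace R.
Let rhoP := ri_rhoP X.

(** For positive [t] this is [t / (t + s)]: up to the factor [t], the kernel of the Stieltjes
    transform. *)
Definition hilbert_kernel (t s : R) : \bar R := ((1 + s / t)^-1)%:E.

Lemma hilbert_kernel_den (t s : R) : (0 < t)%R -> (0 < s)%R -> (0 < 1 + s / t)%R.
Proof. by move=> t0 s0; rewrite addr_gt0// divr_gt0. Qed.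

Lemma Mplus_hilbert_kernel (t : R) : (0 < t)%R -> Mplus (hilbert_kernel t).
Proof.
move=> t0; split=> [|s /halflineE s0]; last first.
  by rewrite lee_fin invr_ge0 ltW// hilbert_kernel_den.
apply/measurable_EFinP; apply: nincr_halfline_measurable => s r s0 sr.
have r0 : (0 < r)%R by exact: lt_le_trans sr.
by rewrite lef_pV2 ?posrE ?hilbert_kernel_den// lerD2l ler_pM2r ?invr_gt0.
Qed.

Lemma MplusA (f : R -> \bar R) : measurable_fun halfline f ->
  Mplus (fun x => `|f x|).
Proof.
by move=> mf; split; [exact: measurableT_comp|move=> x _; exact: abse_ge0].
Qed.

Lemma WE (t : R) : (0 < t)%R -> W X t = ri_rho X (hilbert_kernel t).
Proof.
move=> t0; have Mk := Mplus_hilbert_kernel t0; have [mk k0] := Mk.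
apply: (rho_eqW rhoP) => //; first exact: MplusA mk.
by move=> s /k0 ks; rewrite gee0_abs.
Qed.

Lemma W_gt0 (t : R) : (0 < t)%R -> 0 < W X t.
Proof.
move=> t0; rewrite WE//; have Mk := Mplus_hilbert_kernel t0.
rewrite lt0e (rho_ge0 rhoP)// andbT; apply/negP => /eqP.
move=> /(rho_eq0 rhoP Mk) [N [mN N0 sub]].
have : lebesgue_measure (`]0%R, 1%R[%classic : set R) <= lebesgue_measure N.
  apply: le_measure; rewrite ?inE// => s /= /[!in_itv]/= /andP[s0 _].
  apply: sub => /= /(_ ((halflineE s).2 s0)) [] /eqP.
  by rewrite invr_eq0 gt_eqF// hilbert_kernel_den.
by rewrite N0 lebesgue_measure_itv/= lte_fin ltr01 oppr0 adde0 lee_fin ler10.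
Qed.

Lemma le_W (s t : R) : (0 < s)%R -> (s <= t)%R -> W X s <= W X t.
Proof.
move=> s0 st; have t0 : (0 < t)%R by exact: lt_le_trans st.
rewrite !WE//; apply: (rho_leW rhoP); [exact: Mplus_hilbert_kernel..|].
move=> x /halflineE x0; rewrite lee_fin lef_pV2 ?posrE ?hilbert_kernel_den//.
by rewrite lerD2l; apply: ler_wpM2l; [exact: ltW|rewrite lef_pV2].
Qed.

(** [t / s] times the kernel at [s] is [1 / (s / t + x / t)], which dominates the kernel at [t] as
    [s / t <= 1]. This is the decrease of [W X t / t]. *)
Lemma W_le_scale (s t : R) : (0 < s)%R -> (s <= t)%R ->
  W X t <= (t / s)%:E * W X s.
Proof.
move=> s0 st; have t0 : (0 < t)%R by exact: lt_le_trans st.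
have ts : (0 <= t / s)%R by rewrite divr_ge0 ?ltW.
rewrite !WE// -(rhoZ rhoP ts (Mplus_hilbert_kernel s0)).
apply: (rho_leW rhoP); [exact: Mplus_hilbert_kernel|exact/MplusZ/Mplus_hilbert_kernel|].
move=> x /halflineE x0; rewrite -EFinM lee_fin.
have -> : (t / s * (1 + x / s)^-1 = (s / t + x / t)^-1)%R.
  field; rewrite !gt_eqF//=; rewrite ?addr_gt0//.
rewrite lef_pV2 ?posrE ?hilbert_kernel_den ?addr_gt0 ?divr_gt0//.
by rewrite lerD2r ler_pdivrMr// mul1r.
Qed.

Lemma W_lty (s t : R) : (0 < s)%R -> (0 < t)%R -> W X s < +oo -> W X t < +oo.
Proof.
move=> s0 t0 ws; have [st|ts] := leP s t.
  rewrite (le_lt_trans (W_le_scale s0 st))// lte_mul_pinfty//.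
  by rewrite lee_fin divr_ge0// ltW.
by rewrite (le_lt_trans (le_W t0 (ltW ts))).
Qed.

Lemma W_fineK (t : R) : (0 < t)%R -> W X t < +oo -> (fine (W X t))%:E = W X t.
Proof. by move=> t0 wt; rewrite fineK// ge0_fin_numE// ltW// W_gt0. Qed.

Lemma quasi_concave_W : W X 1 < +oo -> quasi_concave (fun t => fine (W X t)).
Proof.
move=> w1; have wt (t : R) : (0 < t)%R -> W X t < +oo.
  by move=> t0; exact: W_lty w1.
split.
- by move=> t t0; rewrite -lte_fin W_fineK ?wt// W_gt0.
- move=> s t s0 st; have t0 : (0 < t)%R by exact: lt_le_trans st.
  by rewrite -lee_fin !W_fineK ?wt// le_W.
- move=> s t s0 st; have t0 : (0 < t)%R by exact: lt_le_trans st.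
  rewrite ler_pdivrMr// -lee_fin.
  rewrite (_ : fine (W X s) / s * t = t / s * fine (W X s))%R; last by ring.
  by rewrite EFinM !W_fineK ?wt// W_le_scale.
Qed.

End W.

(** * Bounding the Hardy operator through indicators *)

Section Hardy_bounded.
Context {R : realType}.
Variables (phi : R -> R) (X : riSpace R) (K : R).
Hypotheses (phi_qc : quasi_concave phi) (K0 : (0 < K)%R).
Hypothesis WK : forall t : R, (0 < t)%R -> W X t <= (K * phi t)%:E.
Let rhoP := ri_rhoP X.

Lemma Mplus_Hardy_indic (E : set R) : measurable E ->
  Mplus (Hardy (fun x : R => (\1_E x)%:E)).
Proof.
move=> mE; split=> [|t /halflineE t0]; last by apply: Hardy_ge0 => // x; rewrite lee_fin.
by apply: measurable_Hardy; apply/measurable_EFinP/measurable_indic.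
Qed.

Lemma lebesgue_measure_itv0 (t : R) : (0 < t)%R ->
  lebesgue_measure (`]0%R, t[%classic : set R) = t%:E.
Proof. by move=> t0; rewrite lebesgue_measure_itv/= lte_fin t0 oppr0 adde0. Qed.

Lemma Hardy_indic_le1 (E : set R) (t : R) : measurable E -> (0 < t)%R ->
  Hardy (fun x : R => (\1_E x)%:E) t <= 1.
Proof.
move=> mE t0; rewrite Hardy_indic// lee_pdivrMl// mule1 -lebesgue_measure_itv0//.
by apply: le_measure; rewrite ?inE//; exact: measurableI.
Qed.

(** The average is at most 1 and at most [d / t]. Twice the kernel is at least 1 for [t <= d] and at
    least [d / t] for [t > d]. *)
Lemma Hardy_indic_le_kernel (E : set R) (d t : R) : measurable E -> (0 < t)%R ->
  (0 < d)%R -> lebesgue_measure E = d%:E ->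
  Hardy (fun x : R => (\1_E x)%:E) t <= 2%:E * hilbert_kernel d t.
Proof.
move=> mE t0 d0 Ed; have kd := hilbert_kernel_den d0 t0.
rewrite /hilbert_kernel -EFinM; have [td|dt] := leP t d.
  rewrite (le_trans (Hardy_indic_le1 mE t0))// lee_fin ler_pdivlMr// mul1r.
  by rewrite (_ : 2 = 1 + 1)%R// lerD2l ler_pdivrMr// mul1r.
rewrite Hardy_indic// (@le_trans _ _ ((t^-1)%:E * d%:E))//.
  apply: lee_wpmul2l; first by rewrite lee_fin invr_ge0 ltW.
  rewrite -Ed; apply: le_measure; rewrite ?inE//; exact: measurableI.
rewrite -EFinM lee_fin ler_pdivlMr//.
rewrite (_ : t^-1 * d * (1 + t / d) = (d + t) / t)%R; last first.
  by field; rewrite !gt_eqF.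
by rewrite ler_pdivrMr//; lra.
Qed.

Lemma rho_Hardy_indic (E : set R) : measurable E ->
  ri_rho X (Hardy (fun x : R => (\1_E x)%:E)) <=
  (2 * K)%:E * ext_phi phi (lebesgue_measure E).
Proof.
move=> mE; have MH := Mplus_Hardy_indic mE.
have [phi0 _ _] := phi_qc.
have : 0 <= lebesgue_measure E by exact: measure_ge0.
case Ed : (lebesgue_measure E) => [d| |//]; last move=> _.
  rewrite lee_fin => d_ge0; have [d0|nd0] := eqVneq d 0%R.
    rewrite d0 ext_phi0 mule0 -(rho0 rhoP); apply: (rho_leW rhoP) => //.
    move=> t /halflineE t0; rewrite Hardy_indic// lee_pdivrMl// mule0.
    rewrite [leRHS](_ : _ = lebesgue_measure E); last by rewrite Ed d0.
    by apply: le_measure; rewrite ?inE//; exact: measurableI.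
  have d0 : (0 < d)%R by rewrite lt_neqAle eq_sym nd0.
  have Mk := Mplus_hilbert_kernel d0.
  rewrite ext_phi_fin// (@le_trans _ _ (2%:E * W X d))//; last first.
    by rewrite EFinM -muleA lee_wpmul2l// -EFinM WK.
  rewrite WE// -(rhoZ rhoP)//; apply: (rho_leW rhoP) => //; first exact: MplusZ.
  by move=> t /halflineE t0; exact: Hardy_indic_le_kernel.
(* For [E] of infinite measure, the kernels at [n + 1] increase to 1, which dominates every average;
   the Fatou property bounds the norm of 1 by a multiple of the supremum of [phi]. *)
pose u (n : nat) := hilbert_kernel (n.+1%:R : R).
have Mu n : Mplus (u n) by exact: Mplus_hilbert_kernel.
have M1 : Mplus (fun=> 1 : \bar R) by exact: Mplus_cst.
have [|_ cu] := rho_fatou rhoP Mu M1.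
  apply: halfline_ae => x /halflineE x0; split=> [n|].
    rewrite lee_fin lef_pV2 ?posrE ?hilbert_kernel_den//.
    rewrite lerD2l; apply: ler_wpM2l; first exact: ltW.
    by rewrite lef_pV2 ?posrE// ler_nat.
  apply: cvg_EFin; first exact: nearW.
  rewrite -[X in _ --> X]invr1; apply: cvgV => //.
  rewrite -[X in _ --> X]addr0; apply: cvgD; first exact: cvg_cst.
  rewrite -(mulr0 x); apply: cvgMl_tmp; exact: cvg_harmonic.
rewrite (@le_trans _ _ (ri_rho X (fun=> 1)))//.
  apply: (rho_leW rhoP) => // t /halflineE t0; exact: Hardy_indic_le1.
apply: (cvge_le _ cu); apply: nearW => n.
rewrite -WE// (le_trans (WK _))// (@le_trans _ _ ((2 * K)%:E * (phi n.+1%:R)%:E))//.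
  by rewrite -EFinM lee_fin ler_wpM2r ?ler_peMl ?ltW// ?phi0// ltr1n.
rewrite lee_wpmul2l//; first by rewrite lee_fin mulr_ge0// ltW.
by apply: ext_phi_ge => //; exact: leey.
Qed.

(** The constant is [2 * 2 * 4] times [K]: the layers of [|f|], the kernel bound on indicators, and
    the dyadic form of the Lorentz norm. *)
Lemma Hardy_bounded : bounded_operator Hardy (Lorentz phi) X.
Proof.
have K16 : (0 < 16 * K)%R by rewrite mulr_gt0.
exists (16 * K)%R => // f [mf foo].
suff le : ri_rho X (fun x => `|Hardy f x|) <= (16 * K)%:E * Lorentz_norm phi f.
  split; last exact: le.
  split; first exact: measurable_Hardy.
  by apply: (le_lt_trans le); rewrite lte_mul_pinfty// ?lee_fin ?ltW.
pose c (j : nat) : R := dyadic j.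
have c0 j : (0 <= c j)%R by rewrite ltW// dyadic_gt0.
pose E j := level f (c j).
have mE j : measurable (E j) by exact: measurable_level.
pose h j t := (c j)%:E * Hardy (fun x : R => (\1_(E j) x)%:E) t.
have Mh j : Mplus (h j) by exact/MplusZ/Mplus_Hardy_indic.
have [_ le4] := Lorentz_norm_dyadic phi_qc mf.
have K4 : (0 <= 4 * K)%R by rewrite mulr_ge0// ltW.
rewrite (_ : 16 * K = 4 * K * 4)%R; last by ring.
rewrite EFinM -muleA.
apply: (@le_trans _ _ ((4 * K)%:E * dyadic_sum phi f)); last exact: lee_wpmul2l.
have Ms := Mplus_nneseries Mh.
apply: (@le_trans _ _ (ri_rho X (fun t => 2%:E * \sum_(j <oo) h j t))).
  apply: (rho_leW rhoP).
  - by apply: MplusA; exact: measurable_Hardy.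
  - exact: (MplusZ (a := 2) _ Ms).
  - move=> t /halflineE t0; exact: abse_Hardy_le.
rewrite (rhoZ rhoP)// (_ : 4 * K = 2 * (2 * K))%R; last by ring.
rewrite EFinM -muleA lee_wpmul2l// (le_trans (rho_nneseries rhoP Mh))//.
have e0 j : 0 <= (c j)%:E * ext_phi phi (distr f (c j)).
  by apply: mule_ge0; rewrite ?lee_fin ?ext_phi_ge0 ?distr_ge0.
rewrite /dyadic_sum -nneseriesZl//; apply: lee_nneseries => [j _ _|j _].
  exact: (rho_ge0 rhoP).
have -> : ri_rho X (h j) =
    (c j)%:E * ri_rho X (Hardy (fun x : R => (\1_(E j) x)%:E)).
  by rewrite -(rhoZ rhoP (c0 j) (Mplus_Hardy_indic (mE j))).
rewrite muleCA; apply: lee_wpmul2l; first by rewrite lee_fin.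
exact: (rho_Hardy_indic (mE j)).
Qed.

End Hardy_bounded.

(** * The minimal range *)

Lemma Hardy_itv0 {R : realType} (t s : R) : (0 < t)%R -> (0 < s)%R ->
  Hardy (fun x : R => (\1_(`]0%R, t[%classic) x)%:E) s = (Num.min t s / s)%:E.
Proof.
move=> t0 s0; rewrite Hardy_indic//.
have -> : `]0%R, t[ `&` `]0%R, s[ = `]0%R, Num.min t s[%classic.
  apply/seteqP; split=> x /=; rewrite !in_itv/= lt_min.
    by move=> [/andP[-> ->] /andP[_ ->]].
  by move=> /and3P[-> -> ->].
by rewrite lebesgue_measure_itv0 ?lt_min ?t0// -EFinM mulrC.
Qed.

Lemma Lorentz_norm_itv0 {R : realType} (phi : R -> R) (t : R) :
  quasi_concave phi -> (0 < t)%R ->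
  (8^-1 * phi t)%:E <=
    Lorentz_norm phi (fun x : R => (\1_(`]0%R, t[%classic) x)%:E) <=
  (8 * phi t)%:E.
Proof.
move=> qc t0; apply: Lorentz_norm_indic => //; first exact: itv0_halfline.
exact: lebesgue_measure_itv0.
Qed.

Lemma Lorentz_itv0 {R : realType} (phi : R -> R) (t : R) :
  quasi_concave phi -> (0 < t)%R ->
  carrier (Lorentz phi) (fun x : R => (\1_(`]0%R, t[%classic) x)%:E).
Proof.
move=> qc t0; split; first exact/measurable_EFinP/measurable_indic.
by have /andP[_ h] := Lorentz_norm_itv0 qc t0; rewrite (le_lt_trans h)// ltry.
Qed.

Section RX.
Context {R : realType}.
Variable X : riSpace R.

Lemma carrier_hilbert_kernel (t : R) : (0 < t)%R -> W X t < +oo ->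
  carrier X (hilbert_kernel t).
Proof. by move=> t0 wt; have [mk _] := Mplus_hilbert_kernel t0. Qed.

Lemma hilbert_kernel1 : (fun s : R => ((1 + s)^-1)%:E) = hilbert_kernel 1.
Proof. by apply/funext => s; rewrite /hilbert_kernel divr1. Qed.

Lemma RXE : W X 1 < +oo -> RX X = Lorentz (fun t => fine (W X t)).
Proof.
move=> w1; rewrite /RX hilbert_kernel1 asboolT//.
exact: carrier_hilbert_kernel.
Qed.

(** Both spaces are tested on indicators of [(0, t)], whose Lorentz norms are comparable with
    [fine (W X t)] and [phi t]. The indicator of [(0, 1)] already rules out [zero_space], which is
    the case [W X 1 = +oo]. *)
Lemma RX_Lorentz_equiv (phi : R -> R) : quasi_concave phi ->
  space_eq (RX X) (Lorentz phi) ->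
  W X 1 < +oo /\ exists2 C : R, (0 < C)%R & forall t : R, (0 < t)%R ->
    (fine (W X t) <= C * phi t)%R /\ (phi t <= C * fine (W X t))%R.
Proof.
move=> qc; have [W1|W1] := pselect (W X 1 < +oo); last first.
  rewrite /RX hilbert_kernel1 asboolF; last by move=> [_ ?].
  move=> [/(_ (fun x : R => (\1_(`]0%R, 1%R[%classic) x)%:E)) [_ h] _].
  have [_ [N [mN N0 sub]]] := h (Lorentz_itv0 qc ltr01).
  have : lebesgue_measure (`]0%R, 1%R[%classic : set R) <= lebesgue_measure N.
    apply: le_measure; rewrite ?inE// => s s01; apply: sub => /=.
    move=> /(_ (itv0_halfline s01)); rewrite indicE mem_set// => /eqP.
    by rewrite eqe oner_eq0.
  by rewrite N0 lebesgue_measure_itv0// lee_fin ler10.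
rewrite RXE// => -[eqX [c [C [c0 C0 le]]]]; split => //.
set psi := fun t => fine (W X t) in eqX le *.
have qpsi : quasi_concave psi by exact: quasi_concave_W.
(* 64 is [8 * 8], from the two-sided bounds on indicators; the sum [c^-1 + C] serves both directions
   at once. *)
pose D := (64 * (c^-1 + C))%R.
have ci : (0 < c^-1)%R by rewrite invr_gt0.
exists D => [|t t0]; first by rewrite mulr_gt0// addr_gt0.
have [phi0 _ _] := qc; have [psi0 _ _] := qpsi.
have /andP[a1 a2] := Lorentz_norm_itv0 qc t0.
have /andP[b1 b2] := Lorentz_norm_itv0 qpsi t0.
have /andP[le1 le2] := le _ (Lorentz_itv0 qpsi t0).
have pt := phi0 _ t0; have qt := psi0 _ t0.
split.
  have : (c%:E * (8^-1 * psi t)%:E <= (8 * phi t)%:E).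
    apply: le_trans a2; apply: le_trans le1.
    by apply: lee_wpmul2l => //; rewrite lee_fin ltW.
  rewrite -EFinM lee_fin => h.
  have {}h : (psi t <= 64 * c^-1 * phi t)%R.
    have := ler_wpM2l (ltW ci) h; rewrite mulrA mulVf ?gt_eqF// mul1r; lra.
  apply: (le_trans h); rewrite /D ler_pM2r// ler_pM2l// lerDl.
  exact: ltW.
have : (8^-1 * phi t)%:E <= C%:E * (8 * psi t)%:E.
  apply: (le_trans a1); apply: (le_trans le2).
  by apply: lee_wpmul2l => //; rewrite lee_fin ltW.
rewrite -EFinM lee_fin => h.
have {}h : (phi t <= 64 * C * psi t)%R by nra.
apply: (le_trans h); rewrite /D ler_pM2r// ler_pM2l// lerDr.
exact: ltW.
Qed.

End RX.

Section minimal_range.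
Context {R : realType}.
Variable phi : R -> R.
Hypothesis phi_qc : quasi_concave phi.

Definition scale_ri (Z : riSpace R) (c : R) (c0 : (0 < c)%R) : riSpace R :=
  RiSpace (scale_ri_norm (ri_rhoP Z) c0).

(** Fixing the constant 1 is what makes a supremum over all these norms possible: otherwise every
    multiple of a norm would compete. *)
Definition Hardy_contractive : set (riSpace R) :=
  [set Z | forall f, carrier (Lorentz phi) f ->
     ri_rho Z (fun x => `|Hardy f x|) <= Lorentz_norm phi f].

Lemma scale_Hardy_contractive (Z : riSpace R) :
  bounded_operator Hardy (Lorentz phi) Z ->
  exists2 C : R, (0 < C)%R & exists c0, Hardy_contractive (@scale_ri Z C^-1 c0).
Proof.
move=> [C C0 h]; have ci : (0 < C^-1)%R by rewrite invr_gt0.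
exists C => //; exists ci => f Lf; have [_ le] := h f Lf.
by rewrite /= lee_pdivrMl.
Qed.

(** By rearrangement invariance [E] may be replaced by [(0, e)], where the Hardy average of the
    indicator of [(0, e + 1)] equals 1; contractivity then bounds the norm uniformly in [Z]. The
    length [e + 1] is positive even if [E] is null. *)
Lemma Hardy_contractive_indic (E : set R) : measurable E -> E `<=` halfline ->
  lebesgue_measure E < +oo ->
  exists M : R, forall Z, Hardy_contractive Z ->
    ri_rho Z (fun x => (\1_E x)%:E) <= M%:E.
Proof.
move=> mE E0 Efin.
have Efn : lebesgue_measure E \is a fin_num by rewrite ge0_fin_numE.
pose e := fine (lebesgue_measure E).
have e0 : (0 <= e)%R by exact/fine_ge0/measure_ge0.
have d0 : (0 < e + 1)%R by rewrite ltr_wpDl.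
exists (8 * phi (e + 1))%R => Z HZ; have rhoP := ri_rhoP Z.
have M1 (A : set R) : measurable A -> Mplus (fun x : R => (\1_A x)%:E).
  move=> mA; split; first exact/measurable_EFinP/measurable_indic.
  by move=> x _; rewrite lee_fin.
have ie : lebesgue_measure (`]0%R, e[%classic : set R) = lebesgue_measure E.
  rewrite lebesgue_measure_itv/= -(fineK Efn) -/e lte_fin; case: ifPn => [_|].
    by rewrite oppr0 adde0.
  by rewrite -leNgt => e1; congr _%:E; apply/eqP; rewrite eq_le e0 e1.
have -> : ri_rho Z (fun x => (\1_E x)%:E) =
    ri_rho Z (fun x => (\1_(`]0%R, e[%classic) x)%:E).
  apply: (rho_ri rhoP); [exact: M1|exact: M1|exact: halfline_ae|exact: halfline_ae|].
  move=> s s0; rewrite !distr_indic ?ie//; exact: itv0_halfline.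
have LI := Lorentz_itv0 phi_qc d0; have [mI _] := LI.
have /andP[_ le8] := Lorentz_norm_itv0 phi_qc d0.
apply: (le_trans _ (le_trans (HZ _ LI) le8)).
apply: (rho_leW rhoP); [exact: M1|apply: MplusA; exact: measurable_Hardy|].
move=> x /halflineE x0; rewrite Hardy_itv0// indicE.
case: (boolP (x \in _)) => [/set_mem/=|_]; last exact: abse_ge0.
rewrite in_itv/= => /andP[_ xe].
have xd : (x <= e + 1)%R by rewrite (le_trans (ltW xe))// lerDl.
by rewrite min_r// divff ?gt_eqF//= normr1.
Qed.

(** [X] makes the family nonempty. A space [Z] with constant [D] belongs to it once its norm is
    divided by [D], which gives the inclusion with that constant. *)
Lemma minimal_range_exists (X : riSpace R) :
  bounded_operator Hardy (Lorentz phi) X ->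
  exists Y : riSpace R, is_minimal_range phi Y.
Proof.
move=> bX; have [C C0 [c0 FX]] := scale_Hardy_contractive bX.
have nF : Hardy_contractive !=set0 by eexists; exact: FX.
pose Y := RiSpace (sup_ri_norm nF Hardy_contractive_indic).
exists Y; split.
  exists 1%R => // f Lf; have [mf foo] := Lf.
  have le : ri_rho Y (fun x => `|Hardy f x|) <= Lorentz_norm phi f.
    by apply: sup_rho_le => Z; exact.
  split; last by rewrite mul1e.
  by split; [exact: measurable_Hardy|exact: le_lt_trans foo].
move=> Z bZ; have [D D0 [d0 FZ]] := scale_Hardy_contractive bZ.
exists D => // f [mf foo].
have le : ri_rho Z (fun x => `|f x|) <= D%:E * ri_rho Y (fun x => `|f x|).
  by rewrite -lee_pdivrMl//; exact: (sup_rho_ge _ FZ).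
split => //; split => //; apply: (le_lt_trans le).
by rewrite lte_mul_pinfty ?lee_fin ?ltW.
Qed.

Lemma bounded_Hardy_W (Y : riSpace R) :
  bounded_operator Hardy (Lorentz phi) Y ->
  exists2 C : R, (0 < C)%R & forall t : R, (0 < t)%R -> W Y t <= (C * phi t)%:E.
Proof.
move=> [C C0 h]; exists (8 * C)%R => [|t t0]; first by rewrite mulr_gt0.
have LI := Lorentz_itv0 phi_qc t0; have [mI _] := LI.
have [_ le] := h _ LI; have /andP[_ le8] := Lorentz_norm_itv0 phi_qc t0.
have le' : C%:E * Lorentz_norm phi (fun x : R => (\1_(`]0%R, t[%classic) x)%:E)
    <= (8 * C * phi t)%:E.
  rewrite (_ : 8 * C * phi t = C * (8 * phi t))%R; last by ring.
  by rewrite EFinM; apply: lee_wpmul2l => //; rewrite lee_fin ltW.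
apply: (le_trans _ (le_trans le le')); rewrite WE//.
apply: (rho_leW (ri_rhoP Y)); [exact: Mplus_hilbert_kernel|apply: MplusA; exact: measurable_Hardy|].
move=> x /halflineE x0; rewrite Hardy_itv0//.
have den := hilbert_kernel_den t0 x0.
rewrite lee_fin; have [tx|xt] := leP t x.
  rewrite ger0_norm; last by rewrite divr_ge0 ?ltW.
  rewrite -[leRHS]invf_div lef_pV2 ?posrE ?divr_gt0//.
  by rewrite lerDr.
rewrite divff ?gt_eqF// normr1 invf_le1// lerDl divr_ge0 ?ltW//.
Qed.

End minimal_range.

Theorem corollary2p4 (R : realType) (phi : R -> R)
    (phi_qc : quasi_concave phi)
    (phi_log : exists2 C : R, (0 < C)%R &
       forall t : R, (0 < t)%R -> (C * t * ln (1 + t^-1) <= phi t)%R)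
    (phi_RX : exists X : riSpace R, space_eq (RX X) (Lorentz phi)) :
  (exists Y : riSpace R, is_minimal_range phi Y) /\
  (forall Y : riSpace R, is_minimal_range phi Y ->
     space_eq (RX Y) (Lorentz phi)).
Proof.
have [X eqX] := phi_RX.
have [X1 [K K0 WphiX]] := RX_Lorentz_equiv phi_qc eqX.
have XK (t : R) : (0 < t)%R -> (W X t <= (K * phi t)%:E)%E.
  move=> t0; have [h _] := WphiX t t0.
  by rewrite -W_fineK ?lee_fin//; exact: W_lty X1.
have bX := Hardy_bounded phi_qc K0 XK.
split; first exact: minimal_range_exists bX.
move=> Y [bY minY]; have [C C0 YC] := bounded_Hardy_W phi_qc bY.
(* Finiteness of [W Y] puts the kernels into [Y]: [RX Y] is then a Lorentz space, and the inclusion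
   of [Y] in [X] may be tested on them. *)
have Yfin (t : R) : (0 < t)%R -> (W Y t < +oo)%E.
  by move=> t0; rewrite (le_lt_trans (YC _ t0))// ltry.
have [D D0 YX] := minY X bX.
have qY := quasi_concave_W (Yfin 1%R ltr01).
rewrite RXE; last exact: Yfin.
apply: (@Lorentz_space_eq _ _ _ C (K * D)%R) => //; first exact: mulr_gt0.
  by move=> t t0; rewrite -lee_fin W_fineK ?Yfin// YC.
move=> t t0; have [_ h] := WphiX t t0; apply: (le_trans h).
rewrite -mulrA ler_pM2l// -lee_fin EFinM !W_fineK ?Yfin//; last exact: W_lty X1.
by have [_] := YX _ (carrier_hilbert_kernel t0 (Yfin t t0)).
Qed.
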